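(* Let $L$ be a real quadratic field with ring of integers $\mathcal{O}_L$ and fundamental unit $\eta>1$, let $k\in\mathbb{N}$ and define $\rho:=\lfloor k/2\rfloor$. Then, for $X\geq 2$, $$N_{L,k}(X)= c_k\left(\frac{2\log X}{\log\eta}\right)^\rho+O_{k,L}\left((\log X)^{\rho-1}\right),$$ where $c_k=1/\rho!$ if $k$ is even and $c_k=3/\rho!$ if $k$ is odd.
   Context: $\mathbb{N}=\{1,2,3,\ldots\}$. The field $L=\mathbb{Q}(\sqrt d)$, with $d\ge 2$ squarefree, is regarded as a subfield of $\mathbb{R}$; $\mathcal{O}_L^\times$ is the unit group of $\mathcal{O}_L$. Let $N_{L,k}$ be the set of all $n\in\mathbb{Z}$ such that $n=u_1+\cdots+u_r$ for some $r$ with $0\le r\le k$ and some $(u_1,\ldots,u_r)\in(\mathcal{O}_L^\times)^r$ (for $r=0$ the sum is the empty sum $0$). Define $N_{L,k}(X):=\#\{n\in N_{L,k} : |n|\le X\}$. The notation $O_{k,L}(\cdot)$ means that the implied constant depends only on $k$ and $L$, with the bound holding for all real $X\ge 2$. *)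

(* Defs.v *)
From mathcomp Require Import all_boot all_order all_algebra finmap.
From mathcomp Require Import all_classical all_reals all_analysis.
Set Implicit Arguments.
Unset Strict Implicit.
Unset Printing Implicit Defensive.
Import Order.TTheory GRing.Theory Num.Theory.
Local Open Scope classical_set_scope.
Local Open Scope ring_scope.

Definition squarefree (d : nat) : Prop :=
  forall m : nat, (m ^ 2 %| d)%N -> m = 1%N.

Definition quad_field (R : realType) (d : nat) : set R :=
  [set x | exists a b : rat, x = ratr a + ratr b * Num.sqrt d%:R].

Definition ring_of_integers (R : realType) (d : nat) : set R :=
  [set x | quad_field d x /\ integralOver (fun z : int => z%:~R : R) x].

Definition unit_group (R : realType) (d : nat) : set R :=
  [set u | ring_of_integers d u /\
           exists2 v : R, ring_of_integers d v & u * v = 1].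

Definition is_fundamental_unit (R : realType) (d : nat) (eta : R) : Prop :=
  [/\ unit_group d eta, 1 < eta &
      forall u : R, unit_group d u ->
        exists m : int, u = eta ^ m \/ u = - eta ^ m].

Definition unit_sums (R : realType) (d k : nat) : set int :=
  [set n | exists r : nat, (r <= k)%N /\
     exists u : 'I_r -> R, (forall i, unit_group d (u i)) /\
       n%:~R = \sum_(i < r) u i].

Definition unit_sums_upto (R : realType) (d k : nat) (X : R) : set int :=
  [set n | unit_sums R d k n /\ `|n%:~R : R| <= X].

(* [fset_set] sends infinite sets to the empty one, so the count below is only
   meaningful because of this fact. *)
Lemma finite_unit_sums_upto (R : realType) (d k : nat) (X : R) :
  finite_set (unit_sums_upto d k X).
Proof.
have fin (N : nat) : finite_set [set n : int | (`|n| <= N)%N].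
  apply: (@sub_finite_set _ _
    ([set Posz i | i in `I_N.+1] `|` [set - Posz i | i in `I_N.+1])).
    case=> i /= hi; [left; exists i => // | right; exists i.+1 => //].
  by rewrite finite_setU; split; apply: finite_image; exact: finite_II.
apply: sub_finite_set (fin (Num.truncn X)) => n /= [_ hX].
have X0 : 0 <= X by apply: le_trans hX.
by rewrite archimedean.Num.Theory.truncn_ge_nat // natr_absz intr_norm.
Qed.

Definition unit_sums_count (R : realType) (d k : nat) (X : R) : nat :=
  #|` fset_set (unit_sums_upto d k X) |%fset.

Definition main_coef (R : realType) (k : nat) : R :=
  (if odd k then 3 else 1) / (k./2)`!%:R.

(* Main.v *)
Require Import Defs.
From mathcomp Require Import all_boot all_order all_algebra finmap.
From mathcomp Require Import all_classical all_reals all_analysis.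
From mathcomp Require Import ring lra zify.

(** Every unit is a signed power of the fundamental unit [eta], so a counted integer is the
value of a word: a list of at most [k] letters [(b, m)], each standing for
[(-1)^b * eta^m].  Such a value is an integer exactly when it equals its conjugate, the same
word read with the conjugate [eta'] of [eta], and [`|eta'| = eta^-1].

The proof rests on one norm estimate ([gap_cancel]).  Suppose that no letter of an integral
word has an exponent whose absolute value lies in a long range [(T, T + G]].  Let [H] be
the sum of the letters with exponent above [T + G] minus the conjugate of the sum of those
with exponent below [- (T + G)].  As the word equals its conjugate, [H] also equals a sum of
at most [2 * k] terms of size at most [eta^T], while the conjugate of [H] has size at most
[k * eta^-(T + G)].  The norm of [H] is then smaller than 1, so [H = 0]; in other words, the
letters beyond the gap add up to a trace, hence to an integer.

Cutting an integral word at its gaps ([block_decomposition]) leaves clusters of exponents of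
bounded width, each with an integral value.  A nonzero cluster away from the exponent 0
contains positive and negative exponents, so it uses at least two letters and there are at
most [rho = k./2] of them.  A cluster has boundedly many shapes and, by [truncate_word],
[O(log X)] positions, so the integers needing fewer than [rho] clusters number
[O((log X)^(rho - 1))].  If there are [rho] clusters, each has at most three letters, which
makes it plus or minus the trace of a power of [eta] ([far_block_trace]); what remains is an
integer written with at most one unit, and with none if [k] is even.  So all other integers
are sums of [rho] signed traces, plus 0, 1 or -1 when [k] is odd.

Conversely, when the exponents are far apart the largest signed trace can be read off from
such a sum ([leading_code_unique]), so these sums are pairwise distinct.  A signed trace has
[2 * log X / log eta + O(1)] possible values up to size about [X]; both bounds are therefore
a binomial coefficient ['C(2 * log X / log eta + O(1), rho)], times 3 if [k] is odd. *)

Set Implicit Arguments.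
Unset Strict Implicit.
Unset Printing Implicit Defensive.
Import Order.TTheory GRing.Theory Num.Theory.
Local Open Scope ring_scope.

(** * Arithmetic of real quadratic fields *)

Local Notation integral x := (integralOver (fun z : int => z%:~R) x).

(** The rational root theorem: the primitive linear factor of a monic integer polynomial is
monic up to sign, by Gauss's lemma. *)
Lemma integral_rat_int (R : realType) (q : rat) :
  integral (ratr q : R) -> exists n : int, q = n%:~R.
Proof.
move=> [p p_monic].
rewrite (_ : map_poly _ p = map_poly (ratr : rat -> R) (map_poly intr p)); last first.
  by rewrite -map_poly_comp; apply: eq_map_poly => z /=; rewrite ratr_int.
rewrite fmorph_root -dvdp_XsubCl => /dvdpP_rat_int [p1 [a _ Xq] [r pE]].
have lead1 : lead_coef p1 * lead_coef r = 1.
  by rewrite -lead_coefM -pE; apply/eqP; rewrite -monicE.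
have e1 : a * (lead_coef p1)%:~R = 1.
  have := lead_coefXsubC q; rewrite Xq lead_coefZ.
  by rewrite (lead_coef_map_inj (@intr_inj rat)) ?mulr0z.
have e0 : - q = a * (p1`_0)%:~R.
  have := congr1 (fun s : {poly rat} => s`_0) Xq.
  by rewrite coefZ coef_map coefB coefX coefC /= sub0r.
exists (- (p1`_0 * lead_coef r)).
have ar : a = (lead_coef r)%:~R.
  have := mul1r ((lead_coef r)%:~R : rat).
  by rewrite -{1}e1 -mulrA -(@intrM rat) lead1 mulr1.
by rewrite rmorphN rmorphM /= -ar mulrC -e0 opprK.
Qed.

Lemma integral_sqrt (R : realType) (d : nat) : integral (Num.sqrt d%:R : R).
Proof.
exists ('X^2 - d%:R%:P); first by rewrite monicXnsubC.
rewrite rmorphB /= map_polyXn map_polyC /= rootE !hornerE.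
by rewrite sqr_sqrtr ?ler0n // rmorph_nat subrr.
Qed.

(** A rational square root of [d] would be an integer, being integral over the integers. *)
Lemma sqrt_squarefree_irrational (R : realType) (d : nat) :
  (2 <= d)%N -> squarefree d ->
  forall q : rat, Num.sqrt d%:R <> ratr q :> R.
Proof.
move=> d2 dsf q dq.
have [|n qn] := @integral_rat_int R q; first by rewrite -dq; exact: integral_sqrt.
have : (d%:R : R) = (`|n| ^ 2)%N%:R.
  rewrite -(@sqr_sqrtr R d%:R) ?ler0n // dq qn ratr_int.
  by rewrite natrX natr_absz intr_norm real_normK // realz.
move/eqP; rewrite eqr_nat => /eqP dE.
have n1 : `|n|%N = 1%N by apply: dsf; rewrite dE.
by move: d2; rewrite dE n1.
Qed.

Lemma quad_eq0 (R : realType) (d : nat) (a b : rat) :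
  (2 <= d)%N -> squarefree d ->
  ratr a + ratr b * Num.sqrt d%:R = 0 :> R -> a = 0 /\ b = 0.
Proof.
move=> d2 dsf h.
have b0 : b = 0.
  apply/eqP/negPn/negP => bn0; apply: (@sqrt_squarefree_irrational R d d2 dsf (- a / b)).
  have bn : ratr b != 0 :> R by rewrite fmorph_eq0.
  rewrite fmorph_div rmorphN /=; apply: (mulfI bn).
  rewrite [RHS]mulrC divfK //; lra.
split=> //; move: h; rewrite b0 rmorph0 mul0r addr0.
by move/eqP; rewrite fmorph_eq0 => /eqP.
Qed.

(** The sign [e] makes one computation serve for both conjugates: the rational coordinates
[A] and [B] of the value of [p] are the same for [e = 1] and [e = -1]. *)
Lemma horner_quad_conj (R : realType) (d : nat) (a b : rat) (p : {poly int}) :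
  exists A B : rat, forall e : R, e ^+ 2 = 1 ->
    (map_poly intr p).[ratr a + ratr b * (e * Num.sqrt d%:R)]
    = ratr A + ratr B * (e * Num.sqrt d%:R).
Proof.
elim/poly_ind: p => [|p c [A [B IH]]].
  by exists 0, 0 => e _; rewrite map_poly0 horner0 !rmorph0 mul0r addr0.
exists (A * a + B * b * d%:R + c%:~R), (A * b + B * a) => e e1.
rewrite (rmorphD (map_poly _)) rmorphM /= map_polyX map_polyC hornerMXaddC IH //=.
rewrite !rmorphD !rmorphM /= ratr_int ratr_nat.
have s2 : Num.sqrt (d%:R : R) * Num.sqrt d%:R = d%:R by rewrite -expr2 sqr_sqrtr ?ler0n.
clear IH.
move: (ratr A) (ratr B) (ratr a) (ratr b) (c%:~R) s2 => {}A {}B {}a {}b {}c.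
by move: (Num.sqrt d%:R) e1 => s e1 <-; ring: e1.
Qed.

Lemma integral_conj (R : realType) (d : nat) (a b : rat) :
  (2 <= d)%N -> squarefree d ->
  integral (ratr a + ratr b * Num.sqrt d%:R : R) ->
  integral (ratr a - ratr b * Num.sqrt d%:R : R).
Proof.
move=> d2 dsf [p p_monic p0]; exists p => //.
have [A [B AB]] := @horner_quad_conj R d a b p.
have := AB 1; rewrite expr1n mul1r => /(_ erefl); rewrite (rootP p0) => /esym h.
have [A0 B0] := quad_eq0 d2 dsf h.
have := AB (- 1); rewrite sqrrN expr1n mulN1r mulrN => /(_ erefl) hN.
by apply/rootP; rewrite hN A0 B0 !rmorph0 mul0r addr0.
Qed.

(** All that the counting argument uses about the field: [eta'] is the conjugate of an
irrational unit [eta] of trace in the integers and norm 1 or -1. *)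
Record quadratic_unit (R : realType) (eta eta' : R) : Prop := QuadraticUnit {
  qu_gt1 : 1 < eta;
  qu_trace : exists t : int, eta + eta' = t%:~R;
  qu_norm : exists s : bool, eta * eta' = (-1) ^+ s;
  qu_irrational : forall p q : int, p%:~R + q%:~R * eta = 0 -> q = 0 }.

Lemma unit_int (R : realType) (x y : int) : (x%:~R : R) * y%:~R = 1 ->
  exists s : bool, x = (-1) ^+ s.
Proof.
rewrite -intrM => /eqP; rewrite -[1]/(1%:~R) eqr_int => /eqP h.
have : x \is a GRing.unit by apply/unitrP; exists y; rewrite mulrC.
by move=> /orP[] /eqP ->; [exists false | exists true].
Qed.

Lemma fundamental_quadratic_unit (R : realType) (d : nat) (eta : R) :
  (2 <= d)%N -> squarefree d -> is_fundamental_unit d eta ->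
  exists eta' : R, quadratic_unit eta eta'.
Proof.
move=> d2 dsf [[[[a [b ->]] x_int] [y [[a' [b' ->]] y_int] xy1]] x_gt1 _].
have cx := integral_conj d2 dsf x_int.
have cy := integral_conj d2 dsf y_int.
set s := Num.sqrt d%:R in xy1 x_gt1 x_int y_int cx cy *.
have s2 : s * s = d%:R by rewrite -expr2 sqr_sqrtr ?ler0n.
have cxy1 : (ratr a - ratr b * s) * (ratr a' - ratr b' * s) = 1.
  have h : ratr (a * a' + b * b' * d%:R - 1) + ratr (a * b' + a' * b) * s = 0 :> R.
    rewrite rmorphB !rmorphD !rmorphM /= ratr_nat -s2 rmorph1.
    by move: xy1; lra.
  have [] := quad_eq0 d2 dsf h => /(congr1 (ratr : rat -> R)) + /(congr1 (ratr : rat -> R)).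
  rewrite rmorphB !rmorphD !rmorphM /= ratr_nat -s2 rmorph1 rmorph0; nra.
have bn0 : b != 0.
  apply/negP => /eqP b0; move: x_gt1 x_int xy1 cxy1; rewrite b0 rmorph0 !(mul0r, subr0, addr0).
  rewrite ?(mul0r, subr0, addr0) => a_gt1 /integral_rat_int [n nE].
  rewrite nE ratr_int in a_gt1 * => xy1 cxy1.
  have b'0 : ratr b' * s = 0 by nra.
  move: y_int xy1; rewrite b'0 addr0 => /integral_rat_int [m ->].
  rewrite ratr_int => /unit_int [e nE'].
  by move: a_gt1; rewrite nE' intr_sign; case: e {nE'} => /=; rewrite ?expr0 ?expr1; lra.
exists (ratr a - ratr b * s); split => //.
- have [|n nE] := @integral_rat_int R (a + a).
    rewrite rmorphD /= (_ : _ + _ = (ratr a + ratr b * s) + (ratr a - ratr b * s)); last by ring.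
    exact: integral_add.
  exists n; rewrite -(ratr_int R n) -nE rmorphD /=; ring.
- have normE (u v : rat) : (ratr u + ratr v * s) * (ratr u - ratr v * s) =
      ratr (u * u - v * v * d%:R) :> R.
    by rewrite rmorphB !rmorphM /= ratr_nat -s2; ring.
  have [n nE] : exists n : int, a * a - b * b * d%:R = n%:~R.
    by apply: (@integral_rat_int R); rewrite -normE; exact: integral_mul.
  have [m mE] : exists m : int, a' * a' - b' * b' * d%:R = m%:~R.
    by apply: (@integral_rat_int R); rewrite -normE; exact: integral_mul.
  have [|e eE] := @unit_int R n m; last first.
    by exists e; rewrite normE nE ratr_int eE intr_sign.
  rewrite -(ratr_int R n) -(ratr_int R m) -nE -mE -!normE.
  by rewrite mulrACA xy1 cxy1 mulr1.
- move=> p q h.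
  have h' : ratr (p%:~R + q%:~R * a) + ratr (q%:~R * b) * s = 0 :> R.
    by rewrite -h rmorphD !rmorphM /= !ratr_int; ring.
  have [_ /eqP] := quad_eq0 d2 dsf h'.
  by rewrite mulf_eq0 (negPf bn0) orbF intr_eq0 => /eqP.
Qed.

Lemma ring_of_integersM (R : realType) (d : nat) (x y : R) :
  ring_of_integers d x -> ring_of_integers d y -> ring_of_integers d (x * y).
Proof.
move=> [[a [b xE]] xi] [[a' [b' yE]] yi]; split; last exact: integral_mul.
exists (a * a' + b * b' * d%:R), (a * b' + b * a').
have s2 : Num.sqrt (d%:R : R) * Num.sqrt d%:R = d%:R by rewrite -expr2 sqr_sqrtr ?ler0n.
rewrite xE yE !rmorphD !rmorphM /= ratr_nat; move: (Num.sqrt _) s2 => s <-; ring.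
Qed.

Lemma unit_group1 (R : realType) (d : nat) : unit_group d (1 : R).
Proof.
have int1 : ring_of_integers d (1 : R).
  split; last exact: integral1.
  by exists 1, 0; rewrite rmorph1 rmorph0 mul0r addr0.
by split=> //; exists 1; last exact: mulr1.
Qed.

Lemma unit_groupM (R : realType) (d : nat) (x y : R) :
  unit_group d x -> unit_group d y -> unit_group d (x * y).
Proof.
move=> [xi [x' x'i xx']] [yi [y' y'i yy']]; split; first exact: ring_of_integersM.
by exists (x' * y'); [exact: ring_of_integersM | rewrite mulrACA xx' yy' mulr1].
Qed.

Lemma unit_groupN (R : realType) (d : nat) (x : R) :
  unit_group d x -> unit_group d (- x).
Proof.
have ringN y : ring_of_integers d y -> ring_of_integers d (- y : R).
  move=> [[a [b yE]] yi]; split; last exact: integral_opp.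
  by exists (- a), (- b); rewrite yE !rmorphN mulNr opprD.
by move=> [xi [y yi xy]]; split; [exact: ringN | exists (- y); [exact: ringN | rewrite mulrNN]].
Qed.

Lemma unit_groupV (R : realType) (d : nat) (x : R) :
  unit_group d x -> unit_group d x^-1.
Proof.
move=> [xi [y yi xy]].
have xn0 : x != 0 by apply/eqP => x0; move: xy; rewrite x0 mul0r => /esym/eqP; rewrite oner_eq0.
have -> : x^-1 = y by apply: (mulfI xn0); rewrite divff.
by split=> //; exists x; last by rewrite mulrC.
Qed.

Lemma unit_groupXz (R : realType) (d : nat) (x : R) (m : int) :
  unit_group d x -> unit_group d (x ^ m).
Proof.
move=> ux; have uX n : unit_group d (x ^+ n).
  elim: n => [|n IH]; first by rewrite expr0; exact: unit_group1.
  by rewrite exprS; exact: unit_groupM.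
by case: m => n; [exact: uX | apply: unit_groupV; exact: uX].
Qed.

Lemma fundamental_unit_unique (R : realType) (d : nat) (x y : R) :
  is_fundamental_unit d x -> is_fundamental_unit d y -> x = y.
Proof.
suff le (u v : R) : is_fundamental_unit d u -> is_fundamental_unit d v -> u <= v.
  by move=> hx hy; apply/eqP; rewrite eq_le !le.
move=> [_ u1 gen] [vu v1 _]; have [m] := gen v vu.
have u0 : 0 < u by lra.
have um : 0 < u ^ m by exact: exprz_gt0.
case=> vE; last by lra.
case: m um vE => [[|m]|m] um vE.
- by move: v1; rewrite vE expr0z ltxx.
- by rewrite vE exprSz -[leLHS]mulr1 ler_pM2l // exprn_ege1 // ltW.
- move: v1; rewrite vE NegzE -exprnN invf_gt1 ?exprn_gt0 //.
  by rewrite ltNge exprn_ege1 // ltW.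
Qed.

(** * Conjugation on the order generated by a quadratic unit *)

Section QuadraticUnit.
Variables (R : realType) (eta eta' : R).
Hypothesis eta_unit : quadratic_unit eta eta'.

Let eta_gt1 : 1 < eta := qu_gt1 eta_unit.
Let eta_gt0 : 0 < eta := lt_trans ltr01 eta_gt1.

(** The graph of the conjugation of the order of all [p + q * eta]; a relation avoids having to
choose coordinates for a real number of that order. *)
Definition conj_pair (x x' : R) : Prop := exists p q : int,
  x = p%:~R + q%:~R * eta /\ x' = p%:~R + q%:~R * eta'.

Lemma conj_pair_cst (n : int) : conj_pair n%:~R n%:~R.
Proof. by exists n, 0; rewrite !mul0r !addr0. Qed.

Lemma conj_pairD x x' y y' :
  conj_pair x x' -> conj_pair y y' -> conj_pair (x + y) (x' + y').
Proof.
move=> [p [q [-> ->]]] [r [s [-> ->]]].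
by exists (p + r), (q + s); rewrite !intrD; split; ring.
Qed.

Lemma conj_pairN x x' : conj_pair x x' -> conj_pair (- x) (- x').
Proof. by move=> [p [q [-> ->]]]; exists (- p), (- q); rewrite !intrN; split; ring. Qed.

Lemma conj_pairM x x' y y' :
  conj_pair x x' -> conj_pair y y' -> conj_pair (x * y) (x' * y').
Proof.
move=> [p [q [-> ->]]] [r [u [-> ->]]].
have [t tE] := qu_trace eta_unit; have [s sE] := qu_norm eta_unit.
have e2 : eta * eta = t%:~R * eta - (-1) ^+ s by rewrite -tE -sE; ring.
have e2' : eta' * eta' = t%:~R * eta' - (-1) ^+ s by rewrite -tE -sE; ring.
exists (p * r - q * u * (-1) ^+ s), (p * u + q * r + q * u * t).
by rewrite !(intrD, intrB, intrM, intrN) intr_sign; split; ring: e2 e2'.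
Qed.

Lemma conj_pair_sym x x' : conj_pair x x' -> conj_pair x' x.
Proof.
move=> [p [q [-> ->]]]; have [t tE] := qu_trace eta_unit.
by exists (p + q * t), (- q); rewrite intrD intrM intrN -tE; split; ring.
Qed.

Lemma conj_pair_trace x x' : conj_pair x x' -> exists n : int, x + x' = n%:~R.
Proof.
move=> [p [q [-> ->]]]; have [t tE] := qu_trace eta_unit.
by exists (p + p + q * t); rewrite !intrD intrM -tE; ring.
Qed.

Lemma conj_pair_int (n : int) x' : conj_pair n%:~R x' -> x' = n%:~R.
Proof.
move=> [p [q [nE ->]]].
have q0 : q = 0.
  by apply: (qu_irrational eta_unit (p := p - n)); rewrite intrB nE; ring.
by rewrite nE q0 !mul0r.
Qed.

Lemma normr_conj_eta : `|eta'| = eta^-1.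
Proof.
have [s sE] := qu_norm eta_unit.
have /(congr1 Num.norm) := sE; rewrite normrM normr_sign gtr0_norm // => h.
by apply: (mulfI (lt0r_neq0 eta_gt0)); rewrite h divff // lt0r_neq0.
Qed.

Let eta'_neq0 : eta' != 0.
Proof. by rewrite -normr_eq0 normr_conj_eta invr_eq0 lt0r_neq0. Qed.

(** Only integers are fixed by the conjugation, because [eta] and [eta'] differ:
[`|eta'| < 1 < eta]. *)
Lemma conj_pair_fixed x : conj_pair x x -> exists n : int, x = n%:~R.
Proof.
move=> [p [q [xE xE']]]; exists p.
have : q%:~R * (eta - eta') = 0.
  by apply/eqP; rewrite mulrBr subr_eq0; apply/eqP/(addrI p%:~R); rewrite -xE.
move/eqP; rewrite mulf_eq0 => /orP[/eqP q0|]; first by rewrite xE q0 mul0r addr0.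
rewrite subr_eq0 => /eqP e; have := normr_conj_eta; rewrite -e gtr0_norm // => e1.
have : eta^-1 < 1 by rewrite invf_lt1.
by rewrite -e1 ltNge ltW.
Qed.

(** The norm of a nonzero element is a nonzero integer; this is the lower bound against which
all estimates are played. *)
Lemma conj_pair_norm x x' : conj_pair x x' -> x != 0 -> 1 <= `|x| * `|x'|.
Proof.
move=> c x0; have [p [q [xE xE']]] := c.
have [t tE] := qu_trace eta_unit; have [s sE] := qu_norm eta_unit.
have xx' : x * x' = (p * p + p * q * t + q * q * (-1) ^+ s)%:~R.
  by rewrite xE xE' !(intrD, intrM) intr_sign -tE -sE; ring.
have x'0 : x' != 0.
  apply: contra x0 => /eqP x'0; have := conj_pair_sym c; rewrite x'0.
  by move/(@conj_pair_int 0) => ->.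
rewrite -normrM xx' -intr_norm ler1z -gtz0_ge1 normr_gt0.
by rewrite -(intr_eq0 R) -xx' mulf_neq0.
Qed.

Lemma conj_pair_expz (m : int) : conj_pair (eta ^ m) (eta' ^ m).
Proof.
have [t tE] := qu_trace eta_unit; have [s sE] := qu_norm eta_unit.
have c1 : conj_pair eta eta' by exists 0, 1; rewrite !mul1r !add0r.
have cV : conj_pair eta^-1 eta'^-1.
  have := conj_pairM (conj_pair_cst ((-1) ^+ s)) (conj_pair_sym c1).
  rewrite intr_sign.
  have -> : eta^-1 = (-1) ^+ s * eta'.
    apply: (mulfI (lt0r_neq0 eta_gt0)); rewrite divff ?lt0r_neq0 //.
    by rewrite mulrCA sE -signr_addb addbb.
  have -> // : eta'^-1 = (-1) ^+ s * eta.
  apply: (mulfI eta'_neq0); rewrite divff //.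
  by rewrite mulrCA [_ * eta]mulrC sE -signr_addb addbb.
have cX x x' n : conj_pair x x' -> conj_pair (x ^+ n) (x' ^+ n).
  move=> c; elim: n => [|n IH]; first exact: (conj_pair_cst 1).
  by rewrite !exprS; exact: conj_pairM.
case: m => n; first exact: cX.
by rewrite NegzE -!exprnN -!exprVn; exact: cX.
Qed.

Definition letter : Type := (bool * int)%type.
Definition letter_value (u : R) (x : letter) : R := (-1) ^+ x.1 * u ^ x.2.

Lemma conj_pair_letter_value x : conj_pair (letter_value eta x) (letter_value eta' x).
Proof.
apply: conj_pairM; last exact: conj_pair_expz.
by have := conj_pair_cst ((-1) ^+ x.1); rewrite intr_sign.
Qed.

Lemma normr_letter_value x : `|letter_value eta x| = eta ^ x.2.
Proof. by rewrite normrM normr_sign mul1r gtr0_norm // exprz_gt0. Qed.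

Lemma normr_letter_value' x : `|letter_value eta' x| = eta ^ (- x.2).
Proof.
rewrite normrM normr_sign mul1r -exprz_inv -normr_conj_eta.
by case: x.2 => n; rewrite ?NegzE -?exprnN ?normfV -?exprnP normrX.
Qed.

Lemma conj_pair_sum (w : seq letter) (p : pred letter) :
  conj_pair (\sum_(x <- w | p x) letter_value eta x) (\sum_(x <- w | p x) letter_value eta' x).
Proof.
apply: (big_ind2 conj_pair); last by move=> i _; exact: conj_pair_letter_value.
  exact: (conj_pair_cst 0).
by move=> *; exact: conj_pairD.
Qed.

End QuadraticUnit.

(** * Cancellation across a gap of exponents *)

Lemma normr_sum_le (R : realType) (T : eqType) (w : seq T) (f : T -> R) (c : R) :
  (forall x, x \in w -> `|f x| <= c) -> `|\sum_(x <- w) f x| <= (size w)%:R * c.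
Proof.
elim: w => [|x w IH] fc; first by rewrite big_nil normr0 mul0r.
rewrite big_cons (le_trans (ler_normD _ _)) //= mulrS mulrDl mul1r lerD //.
  by apply: fc; rewrite mem_head.
by apply: IH => y yw; apply: fc; rewrite inE yw orbT.
Qed.

Section Gap.
Variables (R : realType) (eta eta' : R).
Hypothesis eta_unit : quadratic_unit eta eta'.

Let eta_gt1 : 1 < eta := qu_gt1 eta_unit.
Let eta_gt0 : 0 < eta := lt_trans ltr01 eta_gt1.

(** With [H] the difference of the two sides of the first equation, [H'] its conjugate and
[w] equal to its conjugate, [H] is at most [2 * k * eta^T] and [H'] at most
[k * eta^-(T + G)] in absolute value; as [2 * k^2 < eta^G], the norm of [H] is smaller than
1, which forces [H = 0]. *)
Lemma gap_cancel (k T G : nat) (w : seq letter) :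
  (size w <= k)%N -> 2 * k%:R ^+ 2 < eta ^+ G ->
  all (fun x => (`|x.2| <= T) || (T + G < `|x.2|))%N w ->
  \sum_(x <- w) letter_value eta x = \sum_(x <- w) letter_value eta' x ->
  \sum_(x <- w | T%:Z < x.2) letter_value eta x
    = \sum_(x <- w | x.2 < - T%:Z) letter_value eta' x /\
  \sum_(x <- w | T%:Z < x.2) letter_value eta' x
    = \sum_(x <- w | x.2 < - T%:Z) letter_value eta x.
Proof.
move=> wk Gk /allP wG VV'.
set P := \sum_(x <- w | T%:Z < x.2) letter_value eta x.
set P' := \sum_(x <- w | T%:Z < x.2) letter_value eta' x.
set Q := \sum_(x <- w | x.2 < - T%:Z) letter_value eta x.
set Q' := \sum_(x <- w | x.2 < - T%:Z) letter_value eta' x.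
have cH : conj_pair eta eta' (P - Q') (P' - Q).
  apply: conj_pairD; first exact: conj_pair_sum.
  by apply: conj_pairN; apply: (conj_pair_sym eta_unit); exact: conj_pair_sum.
(* In [P' - Q] only letters beyond the gap remain, each with exponent at most [- (T + G)]. *)
have H'_le : `|P' - Q| <= k%:R * eta ^ (- (T + G)%:Z).
  rewrite /P' /Q (big_mkcond (fun x : letter => T%:Z < x.2)).
  rewrite (big_mkcond (fun x : letter => x.2 < _)) -sumrB /=.
  apply: (@le_trans _ _ ((size w)%:R * eta ^ (- (T + G)%:Z))); last first.
    by rewrite ler_wpM2r ?ler_nat // exprz_ge0 // ltW.
  apply: normr_sum_le => -[b m] /wG /=; case: ifP => [xp|/negbT xp].
    have -> : (m < - T%:Z) = false by lia.
    move=> h; rewrite subr0 (normr_letter_value' eta_unit) /= ler_eXz2l //; lia.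
  case: ifP => [xn|xn] h; last by rewrite subr0 normr0 exprz_ge0 // ltW.
  by rewrite sub0r normrN (normr_letter_value eta_unit) ler_eXz2l //=; lia.
(* Subtracting the null difference of [w] and its conjugate replaces the letters beyond the gap
   by their small conjugates. *)
have H_le : `|P - Q'| <= k%:R * (2 * eta ^ T%:Z).
  rewrite -[P - Q']subr0 -[X in _ - X](subrr (\sum_(x <- w) letter_value eta x)) {2}VV'.
  rewrite /P /Q' (big_mkcond (fun x : letter => T%:Z < x.2)).
  rewrite (big_mkcond (fun x : letter => x.2 < _)) -!sumrB /=.
  have eT : 1 <= eta ^ T%:Z by rewrite exprn_ege1 // ltW.
  apply: (@le_trans _ _ ((size w)%:R * (2 * eta ^ T%:Z))); last first.
    by rewrite ler_wpM2r ?ler_nat // mulr_ge0 // (le_trans ler01).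
  have le1 (m : int) : m <= 0 -> eta ^ m <= 2 * eta ^ T%:Z.
    move=> m0; have : eta ^ m <= eta ^ 0%:Z by rewrite ler_eXz2l.
    rewrite expr0z; lra.
  apply: normr_sum_le => -[b m] /wG /=; case: ifP => [xp|/negbT xp].
    have -> : (m < - T%:Z) = false by lia.
    move=> h; rewrite subr0 opprB addrC addrNK (normr_letter_value' eta_unit) /=; apply: le1; lia.
  case: ifP => [xn|xn] h.
    rewrite sub0r opprB addrA addNr sub0r normrN (normr_letter_value eta_unit) /=; apply: le1; lia.
  rewrite subr0 sub0r normrN (le_trans (ler_normB _ _)) //.
  rewrite (normr_letter_value eta_unit) /= (normr_letter_value' eta_unit) /=.
  have : eta ^ (m : int) <= eta ^ T%:Z by rewrite ler_eXz2l //; lia.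
  have : eta ^ (- (m : int)) <= eta ^ T%:Z by rewrite ler_eXz2l //; lia.
  lra.
have H0 : P - Q' = 0.
  apply/eqP/negPn/negP => Hn0.
  have := conj_pair_norm eta_unit cH Hn0; apply/negP; rewrite -ltNge.
  apply: le_lt_trans (ler_pM (normr_ge0 _) (normr_ge0 _) H_le H'_le) _.
  have re (a b c : R) : k%:R * (2 * a) * (k%:R * (b * c)) = 2 * k%:R ^+ 2 * (a * b) * c.
    by ring.
  rewrite PoszD opprD expfzDr ?lt0r_neq0 // re.
  rewrite -expfzDr ?lt0r_neq0 // subrr expr0z mulr1 -exprnN ltr_pdivrMr ?exprn_gt0 //.
  by rewrite mul1r.
split; apply/eqP; rewrite -subr_eq0; first by rewrite H0.
move: cH; rewrite H0 => c0; apply/eqP.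
exact: (conj_pair_int eta_unit (n := 0) c0).
Qed.

End Gap.

(** * Integral words and their clusters *)

(** Pigeonhole: [size s + 1] consecutive ranges of length [G] cannot all be hit. *)
Lemma exists_gap (s : seq nat) (a G : nat) :
  exists2 j, (j <= size s)%N &
    all (fun m => (m <= a + j * G) || (a + j * G + G < m))%N s.
Proof.
elim: {s}(size s) {-2}s (erefl (size s)) a => [|n IH] s sn a.
  by case: s sn => // _; exists 0%N.
have [|] := boolP (all (fun m => (m <= a) || (a + G < m))%N s).
  by exists 0%N; rewrite // mul0n addn0.
case/allPn => x xs xG.
have [|j jn /allP h] := IH (rem x s) _ (a + G)%N; first by rewrite size_rem // sn.
exists j.+1; first by move: jn; rewrite size_rem // sn.
apply/allP => y; have := perm_mem (perm_to_rem xs) y; rewrite inE => ->.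
by case/orP => [/eqP ->|/h]; lia.
Qed.

Lemma exists_min (T : eqType) (f : T -> nat) (w : seq T) : w != [::] ->
  exists2 x, x \in w & forall y, y \in w -> (f x <= f y)%N.
Proof.
elim: w => // x [|y w] IH _; first by exists x; rewrite ?mem_head // => y /[!inE] /eqP ->.
have [//|z zw zmin] := IH; have [xz|zx] := leqP (f x) (f z).
  exists x; first exact: mem_head.
  by move=> t; rewrite inE => /orP[/eqP -> //|/zmin]; exact: leq_trans.
exists z; first by rewrite inE zw orbT.
by move=> t; rewrite inE => /orP[/eqP ->|/zmin //]; exact: ltnW.
Qed.

Definition height (x : letter) : nat := `|x.2|%N.

Definition word_value (R : realType) (u : R) (w : seq letter) : R := \sum_(x <- w) letter_value u x.

Section Words.
Variables (R : realType) (eta eta' : R).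
Hypothesis eta_unit : quadratic_unit eta eta'.

Let eta_gt1 : 1 < eta := qu_gt1 eta_unit.
Let eta_gt0 : 0 < eta := lt_trans ltr01 eta_gt1.

(** Equality with the conjugate is the form in which integrality is used; [integral_wordP] says
that it means having an integer value. *)
Definition integral_word (w : seq letter) : Prop := word_value eta w = word_value eta' w.

Lemma conj_pair_word_value w : conj_pair eta eta' (word_value eta w) (word_value eta' w).
Proof. exact: conj_pair_sum. Qed.

Lemma integral_wordP w : integral_word w <-> exists n : int, word_value eta w = n%:~R.
Proof.
have c := conj_pair_word_value w; split=> [h|[n nE]].
  by apply: (conj_pair_fixed eta_unit); move: c; rewrite -h.
by rewrite /integral_word nE; apply/esym/(conj_pair_int eta_unit); rewrite -nE.
Qed.

Lemma word_value_split (u : R) (p : pred letter) w :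
  word_value u w = word_value u [seq x <- w | p x] + word_value u [seq x <- w | ~~ p x].
Proof. by rewrite /word_value !big_filter (bigID p). Qed.

Lemma word_value_high (u : R) T w : word_value u [seq x <- w | T < height x]%N =
  \sum_(x <- w | T%:Z < x.2) letter_value u x + \sum_(x <- w | x.2 < - T%:Z) letter_value u x.
Proof.
rewrite /word_value big_filter (bigID (fun x : letter => 0 < x.2)) /=.
by congr (_ + _); apply: eq_bigl => -[b m]; rewrite /height /=; lia.
Qed.

(** Beyond a gap, the positive exponents contribute the conjugate of what the negative ones
contribute, so their total is its own conjugate. *)
Lemma gap_split (k T G : nat) (w : seq letter) :
  (size w <= k)%N -> 2 * k%:R ^+ 2 < eta ^+ G ->
  all (fun x => (height x <= T) || (T + G < height x))%N w ->
  integral_word w ->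
  integral_word [seq x <- w | T < height x]%N /\
  integral_word [seq x <- w | height x <= T]%N.
Proof.
move=> wk Gk wG wi; have [PQ P'Q] := gap_cancel eta_unit wk Gk wG wi.
have hi : integral_word [seq x <- w | T < height x]%N.
  by rewrite /integral_word !word_value_high PQ P'Q addrC.
have lowE : [seq x <- w | ~~ (T < height x)%N] = [seq x <- w | height x <= T]%N.
  by apply: eq_filter => x; rewrite /= -leqNgt.
split=> //; move: wi; rewrite /integral_word (word_value_split eta (fun x => T < height x)%N).
rewrite (word_value_split eta' (fun x => T < height x)%N) -hi => /addrI.
by rewrite lowE.
Qed.

Lemma normr_word_value_le (k T : nat) w : (size w <= k)%N ->
  all (fun x => height x <= T)%N w -> `|word_value eta w| <= k%:R * eta ^+ T.
Proof.
move=> wk /allP wT; apply: (@le_trans _ _ ((size w)%:R * eta ^+ T)).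
  apply: normr_sum_le => -[b m] /wT; rewrite (normr_letter_value eta_unit) /height /= => h.
  by rewrite exprnP ler_eXz2l //; move: h; clear; lia.
by rewrite ler_wpM2r ?ler_nat // exprn_ge0 // ltW.
Qed.

(** A word of small value may contain large letters that cancel.  Cut it at a gap above
[K + 1]: if the letters beyond the gap had a nonzero value, that value would be a trace
[P + P'] with [P] of size at least [eta^(T + G) / k], too large to be compensated by the
remaining letters and by [X].  So they can be dropped. *)
Lemma truncate_word (k G K : nat) (X : R) (w : seq letter) :
  (0 < k)%N -> 4 * k%:R ^+ 2 < eta ^+ G -> X < eta ^+ K.+1 ->
  (size w <= k)%N -> integral_word w -> `|word_value eta w| <= X ->
  exists w', [/\ (size w' <= k)%N, word_value eta w' = word_value eta w, integral_word w' &
    all (fun x => height x <= K.+1 + k * G)%N w'].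
Proof.
move=> k0 Gk XK wk wi wX.
have k1 : 1 <= k%:R :> R by rewrite ler1n.
have [j jw wG0] := exists_gap (map height w) K.+1 G.
rewrite size_map in jw; set T := (K.+1 + j * G)%N in wG0.
have wG : all (fun x => (height x <= T) || (T + G < height x))%N w by rewrite all_map in wG0.
have Gk' : 2 * k%:R ^+ 2 < eta ^+ G by nra.
have [hi lo] := gap_split wk Gk' wG wi.
have [PQ P'Q] := gap_cancel eta_unit wk Gk' wG wi.
exists [seq x <- w | height x <= T]%N; split=> //.
- by rewrite size_filter (leq_trans (count_size _ _)).
- have wE := word_value_split eta (fun x => T < height x)%N w.
  have lowE : [seq x <- w | ~~ (T < height x)%N] = [seq x <- w | height x <= T]%N.
    by apply: eq_filter => x; rewrite /= -leqNgt.
  rewrite lowE in wE.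
  suff h0 : word_value eta [seq x <- w | T < height x]%N = 0 by rewrite wE h0 add0r.
  have hE : word_value eta [seq x <- w | T < height x]%N =
    \sum_(x <- w | T%:Z < x.2) letter_value eta x + \sum_(x <- w | T%:Z < x.2) letter_value eta' x.
    by rewrite word_value_high P'Q.
  have c := conj_pair_sum eta_unit w (fun x : letter => T%:Z < x.2).
  have P'le : `|\sum_(x <- w | T%:Z < x.2) letter_value eta' x| <= k%:R * eta ^ (- (T + G)%:Z).
    rewrite -big_filter; set v := [seq _ <- _ | _].
    apply: (@le_trans _ _ ((size v)%:R * eta ^ (- (T + G)%:Z))); last first.
      rewrite ler_wpM2r ?ler_nat ?exprz_ge0 ?ltW //.
      by rewrite size_filter (leq_trans (count_size _ _)).
    apply: normr_sum_le => -[b m]; rewrite mem_filter /= => /andP[mT /(allP wG)].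
    by rewrite /height /= (normr_letter_value' eta_unit) ler_eXz2l //=; lia.
  move: c P'le hE.
  move: (\sum_(x <- w | _) letter_value eta x) (\sum_(x <- w | _) letter_value eta' x).
  move=> P P' c P'le hE.
  have [P0|Pn0] := eqVneq P 0.
    rewrite hE P0 add0r; move: c; rewrite P0.
    exact: (conj_pair_int eta_unit (n := 0)).
  exfalso; have := conj_pair_norm eta_unit c Pn0; apply/negP; rewrite -ltNge.
  have lole : `|word_value eta [seq x <- w | height x <= T]%N| <= k%:R * eta ^+ T.
    apply: normr_word_value_le; last exact: filter_all.
    by rewrite size_filter (leq_trans (count_size _ _)).
  have XT : X <= eta ^+ T by rewrite (le_trans (ltW XK)) // ler_eXn2l // leq_addr.
  have T1 : 1 <= eta ^+ T by rewrite exprn_ege1 // ltW.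
  have P'lek : `|P'| <= k%:R.
    apply: le_trans P'le _; rewrite -[leRHS]mulr1 ler_wpM2l ?ler0n //.
    by rewrite -(expr0z eta) ler_eXz2l.
  have Ple : `|P| <= 3 * k%:R * eta ^+ T.
    have -> : P = word_value eta w - P' - word_value eta [seq x <- w | height x <= T]%N.
      by rewrite wE hE; ring.
    apply: le_trans (ler_normB _ _) _.
    have := ler_normB (word_value eta w) P'; nra.
  apply: le_lt_trans (ler_pM (normr_ge0 _) (normr_ge0 _) Ple P'le) _.
  have re (x y z : R) : 3 * k%:R * x * (k%:R * (y * z)) = 3 * k%:R ^+ 2 * (x * y) * z.
    by ring.
  rewrite (exprnP eta T) PoszD opprD expfzDr ?lt0r_neq0 // re.
  rewrite -expfzDr ?lt0r_neq0 // subrr expr0z mulr1 -exprnN ltr_pdivrMr ?exprn_gt0 //.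
  nra.
- apply: sub_all (filter_all _ _) => x; rewrite /T => h; apply: leq_trans h _.
  by rewrite leq_add2l leq_mul2r (leq_trans jw wk) orbT.
Qed.

(** A cluster of width at most [k * G], away from the exponent 0, whose value is a nonzero
integer; [E] bounds all exponents. *)
Definition far_block (k G E : nat) (b : seq letter) : Prop :=
  [/\ (size b <= k)%N, integral_word b, word_value eta b != 0 &
    exists a, [/\ (G < a)%N, (a <= E)%N &
      all (fun x => (a <= height x <= a + k * G) && (height x <= E))%N b]].

(** Peel off the cluster of smallest exponents: it ends at the first gap, within [k * G] of its
start.  A cluster that starts within [G] of 0 goes to [near], one of value zero is discarded. *)
Lemma block_decomposition (k G E : nat) (w : seq letter) :
  2 * k%:R ^+ 2 < eta ^+ G -> (size w <= k)%N -> integral_word w ->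
  all (fun x => height x <= E)%N w ->
  exists near fars, [/\ integral_word near,
    all (fun x => height x <= k.+1 * G)%N near,
    (forall b, b \in fars -> far_block k G E b),
    word_value eta w = word_value eta near + \sum_(b <- fars) word_value eta b &
    (size near + \sum_(b <- fars) size b <= size w)%N].
Proof.
move=> Gk; have [n nw] := ubnP (size w).
elim: n => // n IH in w nw *; move=> wk wi wE.
have [->|wn] := eqVneq w [::].
  by exists [::], [::]; split; rewrite ?big_nil ?addr0 // /integral_word /word_value !big_nil.
have [x xw xmin] := exists_min height wn.
have [j jw wG0] := exists_gap (map height w) (height x) G.
rewrite size_map in jw; set T := (height x + j * G)%N in wG0.
have wG : all (fun x => (height x <= T) || (T + G < height x))%N w by rewrite all_map in wG0.
have [hi lo] := gap_split wk Gk wG wi.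
set wh := [seq x <- w | T < height x]%N in hi.
set wl := [seq x <- w | height x <= T]%N in lo.
have wlE : [seq x <- w | ~~ (T < height x)%N] = wl.
  by apply: eq_filter => y; rewrite /= -leqNgt.
have wlh : (size wl + size wh = size w)%N.
  by rewrite addnC -(count_predC (fun x => T < height x)%N w) -!size_filter wlE.
have wl0 : (0 < size wl)%N.
  by rewrite size_filter -has_count; apply/hasP; exists x; rewrite // leq_addr.
have [||//||near [fars [neari nearG farsP wE' sz]]] := IH wh.
- lia.
- lia.
- by apply/allP => y; rewrite mem_filter => /andP[_ /(allP wE)].
have wvE : word_value eta w =
    word_value eta wl + (word_value eta near + \sum_(b <- fars) word_value eta b).
  by rewrite (word_value_split eta (fun x => T < height x)%N) wlE wE' addrC.
have TE : (T <= height x + k * G)%N.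
  by rewrite leq_add2l leq_mul2r (leq_trans jw wk) orbT.
have [xG|xG] := leqP (height x) G.
  exists (wl ++ near), fars; split=> //.
  - by rewrite /integral_word /word_value !big_cat /= -!/(word_value _ _) lo neari.
  - rewrite all_cat nearG andbT; apply: sub_all (filter_all _ _) => y yT.
    by rewrite mulSn (leq_trans yT) // (leq_trans TE) // leq_add2r.
  - by rewrite wvE /word_value big_cat addrA.
  - by rewrite size_cat -addnA -wlh leq_add2l.
have [wl00|wl00] := eqVneq (word_value eta wl) 0.
  exists near, fars; split=> //; first by rewrite wvE wl00 add0r.
  by rewrite (leq_trans sz) // -wlh leq_addl.
exists near, (wl :: fars); split=> //.
- move=> b; rewrite inE => /orP[/eqP ->|]; last exact: farsP.
  split=> //; first by rewrite (leq_trans _ wk) // -wlh leq_addr.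
  exists (height x); split=> //; first exact: (allP wE).
  apply/allP => y; rewrite mem_filter => /andP[yT yw].
  by rewrite xmin // (leq_trans yT TE) (allP wE).
- by rewrite wvE big_cons; ring.
- by rewrite big_cons addnCA -wlh leq_add2l.
Qed.

(** A natural number [c] encodes a sign, its parity, together with an exponent, its half; this
lets sums of signed traces be counted as multisets or sets of natural numbers. *)
Definition signed_trace (c : nat) : R := (-1) ^+ c * (eta ^+ c./2 + eta' ^+ c./2).

(** For a negative exponent the norm of a power of [eta] may change the sign, so the parity of
the code need not be the sign of the letter. *)
Lemma trace_letter_value x :
  exists2 c, (c./2 = height x)%N & letter_value eta x + letter_value eta' x = signed_trace c.
Proof.
case: x => b m; rewrite /letter_value /height /signed_trace /= -mulrDr.
have par (e : bool) n : ((e + n.*2)./2 = n)%N /\ (-1) ^+ (e + n.*2) = (-1) ^+ e :> R.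
  by rewrite half_bit_double -signr_odd oddD odd_double oddb addbF.
case: m => n.
  by have [h1 h2] := par b n; exists (b + n.*2)%N; rewrite ?h1 ?h2.
have [s sE] := qu_norm eta_unit.
have en0 : eta != 0 by rewrite lt0r_neq0.
have e'n0 : eta' != 0.
  by apply/eqP => e0; move: sE; rewrite e0 mulr0 => /esym/eqP; rewrite signr_eq0.
have Ve : eta^-1 = (-1) ^+ s * eta'.
  by apply: (mulfI en0); rewrite divff // mulrCA sE -signr_addb addbb.
have Ve' : eta'^-1 = (-1) ^+ s * eta.
  by apply: (mulfI e'n0); rewrite divff // mulrCA [_ * eta]mulrC sE -signr_addb addbb.
have [h1 h2] := par (b (+) (s && odd n.+1)) n.+1.
exists ((b (+) (s && odd n.+1)) + n.+1.*2)%N; rewrite h1 ?h2 //.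
rewrite NegzE -!exprnN -!exprVn Ve Ve' !exprMn -mulrDr mulrA [_ + eta ^+ _]addrC.
congr (_ * _); rewrite signr_addb; congr (_ * _).
case: s {sE Ve Ve' h1 h2}; last by rewrite expr0 expr1n.
by rewrite andTb expr1 signr_odd.
Qed.

(** By [gap_cancel] at [T = 0], the letters with positive exponent and those with negative
exponent have conjugate sums, so neither group is empty, the value being
nonzero.  With at most three letters, one group is a single letter, and the value is the
trace of that letter. *)
Lemma far_block_trace (k G E : nat) (b : seq letter) :
  2 * k%:R ^+ 2 < eta ^+ G -> far_block k G E b ->
  (2 <= size b)%N /\ ((size b <= 3)%N ->
    exists2 c, (c < E.+1.*2)%N & word_value eta b = signed_trace c).
Proof.
move=> Gk [bk bi bn0 [a [aG aE bG]]].
have bG0 : all (fun x => (height x <= 0) || (0 + G < height x))%N b.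
  by apply: sub_all bG => y; lia.
have [PQ P'Q] := gap_cancel eta_unit bk Gk bG0 bi.
have bE : word_value eta b =
    \sum_(x <- b | 0%:Z < x.2) letter_value eta x + \sum_(x <- b | x.2 < - 0%:Z) letter_value eta x.
  rewrite -word_value_high; congr (word_value _ _); apply/esym/all_filterP.
  by apply: sub_all bG => y; lia.
have szE : (size [seq x <- b | (0%:Z < x.2)%R] + size [seq x <- b | (x.2 < - 0%:Z)%R] = size b)%N.
  rewrite !size_filter -[RHS](count_predC (fun x : letter => 0%:Z < x.2)); congr (_ + _)%N.
  apply: eq_in_count => -[e m] /(allP bG); rewrite /height /=; lia.
have pE u : \sum_(x <- b | 0%:Z < x.2) letter_value u x =
    \sum_(x <- [seq x <- b | (0%:Z < x.2)%R]) letter_value u x by rewrite big_filter.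
have qE u : \sum_(x <- b | x.2 < - 0%:Z) letter_value u x =
    \sum_(x <- [seq x <- b | (x.2 < - 0%:Z)%R]) letter_value u x by rewrite big_filter.
rewrite !(pE, qE) in PQ P'Q bE; move: {pE qE} PQ P'Q bE szE.
have : {subset [seq x <- b | (0%:Z < x.2)%R] <= b} by exact: mem_subseq (filter_subseq _ _).
have : {subset [seq x <- b | (x.2 < - 0%:Z)%R] <= b} by exact: mem_subseq (filter_subseq _ _).
move: [seq x <- b | (0%:Z < x.2)%R] [seq x <- b | (x.2 < - 0%:Z)%R] => p q qb pb PQ P'Q bE szE.
have p0 : (0 < size p)%N.
  rewrite lt0n size_eq0; apply: contra bn0 => /eqP p0.
  by rewrite bE -P'Q p0 !big_nil addr0.
have q0 : (0 < size q)%N.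
  rewrite lt0n size_eq0; apply: contra bn0 => /eqP q0.
  by rewrite bE PQ q0 !big_nil addr0.
split=> [|b3]; first by lia.
have [x xb ->] : exists2 x, x \in b & word_value eta b = letter_value eta x + letter_value eta' x.
  have [p1|q1] : size p = 1%N \/ size q = 1%N by lia.
    case: p p1 {p0 PQ szE} pb P'Q bE => [//|x [|//]] _ xb; rewrite !big_seq1 => <- ->.
    by exists x; rewrite // xb // mem_head.
  case: q q1 {q0 P'Q szE} qb PQ bE => [//|x [|//]] _ xb; rewrite !big_seq1 => -> ->.
  by exists x; rewrite 1?addrC // xb // mem_head.
have [c cx ->] := trace_letter_value x; exists c => //.
by move/allP: bG => /(_ _ xb); lia.
Qed.

End Words.

(** * Few values: the upper bound *)

Fixpoint sumset (V : nmodType) (j : nat) (S : seq V) : seq V :=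
  if j is j'.+1 then [seq x + y | x <- S, y <- sumset j' S] else [:: 0].

Lemma size_sumset (V : nmodType) j (S : seq V) : size (sumset j S) = (size S ^ j)%N.
Proof. by elim: j => //= j IH; rewrite size_allpairs IH expnS. Qed.

Lemma mem_sumset (V : nmodType) j (S l : seq V) :
  (size l <= j)%N -> 0 \in S -> {subset l <= S} -> \sum_(x <- l) x \in sumset j S.
Proof.
move=> + S0; elim: j l => [|j IH] [|x l] //= lj lS; rewrite ?big_nil ?big_cons ?mem_head //.
  apply/allpairsP; exists (0, 0); rewrite addr0; split=> //.
  by have := IH [::]; rewrite big_nil => ->.
apply/allpairsP; exists (x, \sum_(x <- l) x); split=> //=; first by rewrite lS // mem_head.
by apply: IH => // y yl; rewrite lS // inE yl orbT.
Qed.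

(** The sums of [f] over the multisets of [j] natural numbers below [N]; the recursion on [N]
and [j] is that of Pascal, which yields the count [size_multisums]. *)
Fixpoint multisums (V : nmodType) (f : nat -> V) (N j : nat) {struct j} : seq V :=
  if j is j'.+1 then
    (fix upto n := if n is n'.+1
       then upto n' ++ [seq f n' + y | y <- multisums f n'.+1 j'] else [::]) N
  else [:: 0].

Lemma multisumsn0 (V : nmodType) (f : nat -> V) N : multisums f N 0 = [:: 0].
Proof. by case: N. Qed.

Lemma multisumsSS (V : nmodType) (f : nat -> V) N j : multisums f N.+1 j.+1 =
  multisums f N j.+1 ++ [seq f N + y | y <- multisums f N.+1 j].
Proof. by []. Qed.

Lemma size_multisums (V : nmodType) (f : nat -> V) N j :
  (size (multisums f N j) <= 'C(N + j, j))%N.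
Proof.
elim: j N => [|j IHj] N; first by rewrite multisumsn0 bin0.
elim: N => // N IHN; rewrite multisumsSS size_cat size_map addSn binS.
by rewrite leq_add // -addSnnS.
Qed.

Lemma mem_multisums (V : nmodType) (f : nat -> V) N j l :
  size l = j -> all (fun c => c < N)%N l -> \sum_(c <- l) f c \in multisums f N j.
Proof.
elim: j N l => [|j IHj] N l; first by case: l => // _ _; rewrite big_nil multisumsn0 mem_head.
elim: N l => [|N IHN] l lj lN; first by case: l lj lN.
rewrite multisumsSS mem_cat; have [Nl|Nl] := boolP (N \in l); last first.
  apply/orP; left; apply: IHN => //; apply/allP => c cl.
  move/allP: lN => /(_ c cl); rewrite ltnS leq_eqVlt => /orP[/eqP cN|//].
  by move: Nl; rewrite -cN cl.
apply/orP; right; rewrite (perm_big _ (perm_to_rem Nl)) big_cons; apply: map_f.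
apply: IHj; first by rewrite size_rem // lj.
by apply/allP => c /mem_rem /(allP lN).
Qed.

(** Only 1 and -1 are integers and units, so these are the integers that the [odd k] unit left
over by the traces can contribute. *)
Definition endings (V : zmodType) (one : V) (k : nat) : seq V :=
  if odd k then [:: 0; one; - one] else [:: 0].

Definition letters_near (a h : nat) : seq letter :=
  [seq (b, m) | b <- [:: true; false],
     m <- [seq Posz i | i <- iota a h.+1] ++ [seq - Posz i | i <- iota a h.+1]].

Lemma mem_letters_near a h x : (a <= height x <= a + h)%N -> x \in letters_near a h.
Proof.
case: x => b m; rewrite /height /= => am; apply/allpairsP; exists (b, m); split=> //.
  by case: (b).
rewrite mem_cat; apply/orP; case: m am => n am; [left|right; rewrite NegzE].
  by apply: (map_f Posz); rewrite mem_iota addnS.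
by apply: (map_f (fun i : nat => - Posz i)); rewrite mem_iota addnS.
Qed.

Lemma size_letters_near a h : size (letters_near a h) = (4 * h.+1)%N.
Proof. by rewrite size_allpairs size_cat !size_map size_iota addnn -mul2n mulnA. Qed.

Section Upper.
Variables (R : realType) (eta eta' : R).
Hypothesis eta_unit : quadratic_unit eta eta'.

Let eta_gt1 : 1 < eta := qu_gt1 eta_unit.
Let eta_gt0 : 0 < eta := lt_trans ltr01 eta_gt1.

(** Zero is added to the letters of a cluster so that shorter clusters are covered by sums of
exactly [k] terms. *)
Definition block_values (k G E : nat) : seq R := flatten
  [seq sumset k (0 :: map (letter_value eta) (letters_near a (k * G))) | a <- iota 0 E.+1].

Lemma size_block_values k G E :
  size (block_values k G E) = (E.+1 * (4 * (k * G).+1).+1 ^ k)%N.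
Proof.
rewrite /block_values size_flatten /shape -map_comp.
rewrite (eq_map (g := fun=> ((4 * (k * G).+1).+1 ^ k)%N)); last first.
  move=> a; rewrite /comp size_sumset -(size_letters_near a).
  by rewrite -(size_map (letter_value eta)).
by rewrite sumnE big_map big_const_seq count_predT size_iota iter_addn_0 mulnC.
Qed.

Lemma block_values0 k G E : 0 \in block_values k G E.
Proof.
apply/flatten_mapP; exists 0%N; first by rewrite mem_iota.
have := mem_sumset (l := [::]) (leq0n k) (mem_head 0 [seq letter_value eta x | x <- letters_near 0 (k * G)]).
by rewrite big_nil; apply.
Qed.

Lemma far_block_value k G E b : far_block eta eta' k G E b -> word_value eta b \in block_values k G E.
Proof.
move=> [bk _ _ [a [_ aE bG]]]; apply/flatten_mapP; exists a; first by rewrite mem_iota.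
rewrite /word_value -(big_map (letter_value eta) predT id); apply: mem_sumset.
- by rewrite size_map.
- exact: mem_head.
move=> _ /mapP[x xb ->]; rewrite inE; apply/orP; right; apply/map_f/mem_letters_near.
by move/allP: bG => /(_ _ xb) /andP[].
Qed.

Definition centered (H : nat) : seq R := [seq (i%:R - H%:R) | i <- iota 0 H.*2.+1].

Lemma mem_centered H (n : int) : `|n%:~R : R| <= H%:R -> n%:~R \in centered H.
Proof.
rewrite -intr_norm -[H%:R]/((Posz H)%:~R) ler_int => nH.
apply/mapP; exists `|(n + H%:Z)%R|%N; first by rewrite mem_iota; lia.
by rewrite natr_absz ger0_norm; [rewrite intrD addrK | lia].
Qed.

Definition main_values (k E : nat) : seq R :=
  [seq v + e | v <- multisums (signed_trace eta eta') E.+1.*2 k./2, e <- endings 1 k].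

(** Sums of fewer than [k./2] clusters and a bounded integer; there are none if [k./2 = 0]. *)
Definition exceptional_values (k G E H : nat) : seq R :=
  if k./2 is r.+1
  then [seq v + e | v <- sumset r (block_values k G E), e <- centered H]
  else [::].

(** A single unit is an integer only if its exponent is 0, because conjugation inverts its
absolute value. *)
Lemma integral_word_small w : integral_word eta eta' w -> (size w <= 1)%N ->
  word_value eta w \in endings 1 (size w).
Proof.
rewrite /integral_word /word_value; case: w => [|[b m] [|//]] /=; rewrite ?big_nil ?mem_head //.
rewrite !big_seq1 => h _; have /(congr1 Num.norm) := h.
rewrite (normr_letter_value eta_unit) (normr_letter_value' eta_unit) /=.
move=> /(ieexprIz eta_gt0 (negbT (gt_eqF eta_gt1))) mN.
have -> : m = 0 by lia.
by rewrite /letter_value /= expr0z mulr1; case: b {h}; rewrite ?expr1 ?expr0 !inE eqxx ?orbT.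
Qed.

(** The clusters use at least two letters each.  Either there are fewer than [k./2], and the value
is exceptional, or there are exactly [k./2], all with two or three letters, and at most
[odd k] letters remain near the exponent 0. *)
Lemma word_value_covered (k G K H : nat) (X : R) (w : seq letter) :
  (0 < k)%N -> 4 * k%:R ^+ 2 < eta ^+ G -> X < eta ^+ K.+1 ->
  k%:R * eta ^+ (k.+1 * G) <= H%:R ->
  (size w <= k)%N -> integral_word eta eta' w -> `|word_value eta w| <= X ->
  word_value eta w \in main_values k (K.+1 + k * G) ++ exceptional_values k G (K.+1 + k * G) H.
Proof.
move=> k0 Gk XK kH wk0 wi0 wX; set E := (K.+1 + k * G)%N.
have [w' [wk <- wi wE]] := truncate_word eta_unit k0 Gk XK wk0 wi0 wX.
have Gk' : 2 * k%:R ^+ 2 < eta ^+ G.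
  by apply: le_lt_trans Gk; rewrite ler_wpM2r ?sqr_ge0 // ler_nat.
have [near [fars [ni nG farsP -> sz]]] := block_decomposition eta_unit Gk' wk wi wE.
have far2 b : b \in fars -> (2 <= size b)%N.
  by move/farsP => /(far_block_trace eta_unit Gk') [].
have sz2 : (2 * size fars <= \sum_(b <- fars) size b)%N.
  rewrite mulnC -sum1_size big_distrl /= big_seq [leqRHS]big_seq; apply: leq_sum => b /far2.
  by rewrite mul1n.
have nk : (size near <= k)%N by rewrite (leq_trans _ wk) // (leq_trans _ sz) // leq_addr.
rewrite mem_cat; apply/orP; have [fk|fk] := ltnP (size fars) k./2.
  right; rewrite /exceptional_values; case kr: k./2 fk => [//|r] fr.
  apply/allpairsP; exists (\sum_(b <- fars) word_value eta b, word_value eta near).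
  rewrite addrC; split=> //=.
    rewrite -(big_map (word_value eta) predT id); apply: mem_sumset; rewrite ?size_map //.
      exact: block_values0.
    by move=> _ /mapP[b /farsP bf ->]; exact: far_block_value.
  have [n nE] := (integral_wordP eta_unit near).1 ni.
  rewrite nE; apply: mem_centered; rewrite -nE; apply: le_trans kH.
  exact: (normr_word_value_le eta_unit nk).
left; have k2 := odd_double_half k.
have far3 b : b \in fars -> (size b <= 3)%N.
  move=> bf; move: sz; rewrite (perm_big _ (perm_to_rem bf)) big_cons /= => sz.
  have sz' : (2 * size (rem b fars) <= \sum_(c <- rem b fars) size c)%N.
    rewrite mulnC -sum1_size big_distrl /= big_seq [leqRHS]big_seq; apply: leq_sum => c /mem_rem /far2.
    by rewrite mul1n.
  rewrite size_rem // in sz'.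
  have arith (o h f c s n v : nat) : (o <= 1 -> o + h.*2 = k -> v <= k -> h <= f ->
      2 * f.-1 <= s -> n + (c + s) <= v -> 0 < f -> c <= 3)%N by clear; lia.
  apply: (arith _ _ _ _ _ _ _ (leq_b1 _) k2 wk fk sz' sz).
  by case: (fars) bf.
have [fE n1] : size fars = k./2 /\ (size near <= odd k)%N.
  have arith (o h f s n v : nat) : (o <= 1 -> o + h.*2 = k -> v <= k -> h <= f ->
      2 * f <= s -> n + s <= v -> f = h /\ n <= o)%N by clear; lia.
  exact: (arith _ _ _ _ _ _ (leq_b1 _) k2 wk fk sz2 sz).
have [l [ls lE lv]] : exists l, [/\ size l = size fars, all (fun c => c < E.+1.*2)%N l &
    \sum_(b <- fars) word_value eta b = \sum_(c <- l) signed_trace eta eta' c].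
  have : forall b, b \in fars -> exists2 c, (c < E.+1.*2)%N & word_value eta b = signed_trace eta eta' c.
    by move=> b bf; have [_] := far_block_trace eta_unit Gk' (farsP b bf); apply; exact: far3.
  elim: (fars) => [|b s IH] h; first by exists [::]; rewrite !big_nil.
  have [c cE cv] := h b (mem_head _ _).
  have [|l [ls lE lv]] := IH; first by move=> d ds; apply: h; rewrite inE ds orbT.
  by exists (c :: l); split; rewrite /= ?ls ?cE // !big_cons cv lv.
apply/allpairsP; exists (\sum_(c <- l) signed_trace eta eta' c, word_value eta near).
rewrite lv addrC; split=> //=.
  by apply: mem_multisums => //; rewrite ls.

have := integral_word_small ni (leq_trans n1 (leq_b1 _)).
rewrite /endings; case: (odd k) n1 => n1; last by move: n1; rewrite leqn0 => /eqP ->.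
by case: (odd _) => //; rewrite inE => /eqP ->; rewrite mem_head.
Qed.

Lemma size_main_values k E : (size (main_values k E) <=
  (if odd k then 3 else 1) * 'C(E.+1.*2 + k./2, k./2))%N.
Proof.
rewrite /main_values size_allpairs mulnC leq_mul ?size_multisums //.
by rewrite /endings; case: odd.
Qed.

Lemma size_exceptional_values k G E H : (size (exceptional_values k G E H) <=
  (0 < k./2) * ((E.+1 * (4 * (k * G).+1).+1 ^ k) ^ (k./2).-1 * H.*2.+1))%N.
Proof.
rewrite /exceptional_values; case: k./2 => [//|r]; rewrite mul1n succnK.
by rewrite size_allpairs size_sumset size_block_values size_map size_iota.
Qed.

End Upper.

(** * Distinct values: the lower bound *)

(** The image of the [j]-element subsets of the numbers below [N], listed in decreasing order,
under the spreading map that adds [g * i] to the [i]-th smallest element (counted from 1).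
It forces gaps larger than [g] and keeps the count ['C(N, j)]. *)
Fixpoint gapped_codes (g N j : nat) : seq (seq nat) :=
  match j, N with
  | 0, _ => [:: [::]]
  | _.+1, 0 => [::]
  | j'.+1, N'.+1 => gapped_codes g N' j ++
      [seq (N' + g * j)%N :: l | l <- gapped_codes g N' j']
  end.

Lemma size_gapped_codes g N j : size (gapped_codes g N j) = 'C(N, j).
Proof.
elim: N j => [|N IH] [|j] //=.
by rewrite size_cat size_map !IH binS.
Qed.

Fixpoint gapped (g : nat) (l : seq nat) : bool :=
  if l is c :: l' then [&& (g <= c)%N, all (fun c' => c' + g < c)%N l' & gapped g l']
  else true.

Lemma mem_gapped_codes g N j l : l \in gapped_codes g N j ->
  [/\ size l = j, gapped g l & all (fun c => c < N + g * j)%N l].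
Proof.
elim: N j l => [|N IH] [|j] l /=; rewrite ?inE.
- by move=> /eqP ->.
- by [].
- by move=> /eqP ->.
rewrite mem_cat => /orP[/IH [lj lg lN]|/mapP[l' /IH [lj lg lN] ->]].
  by split=> //; apply: sub_all lN => c h; rewrite addSn ltnW.
split=> /=; rewrite ?lj //.
  rewrite lg andbT (leq_trans _ (leq_addl _ _)) ?leq_pmulr //=.
  by apply: sub_all lN => c h; rewrite mulnS addnCA [(g + _)%N]addnC ltn_add2r.
rewrite addSn leqnn /=; apply: sub_all lN => c h.
by rewrite (leq_trans h) // mulnS addnCA leqW // leq_addl.
Qed.

Lemma uniq_gapped_codes g N j : uniq (gapped_codes g N j).
Proof.
elim: N j => [|N IH] [|j] //=.
rewrite cat_uniq IH map_inj_uniq ?IH ?andbT; last by move=> l l' [].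
apply/hasPn => _ /mapP[l _ ->]; apply/negP => /mem_gapped_codes [_ _ /= /andP[]].
by rewrite ltnn.
Qed.

Lemma normr_ending (R : numDomainType) k (e : R) : e \in endings 1 k -> `|e| <= 1.
Proof.
rewrite /endings; case: (odd k); rewrite !inE; last by move/eqP ->; rewrite normr0 ler01.
by case/or3P => /eqP ->; rewrite ?normrN ?normr1 ?normr0 ?ler01.
Qed.

Section Lower.
Variables (R : realType) (eta eta' : R).
Hypothesis eta_unit : quadratic_unit eta eta'.

Let eta_gt1 : 1 < eta := qu_gt1 eta_unit.
Let eta_gt0 : 0 < eta := lt_trans ltr01 eta_gt1.

Definition code_sum (l : seq nat) (e : R) : R := \sum_(c <- l) signed_trace eta eta' c + e.

Lemma normr_conj_pow a : `|eta' ^+ a| <= 1.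
Proof. by rewrite normrX (normr_conj_eta eta_unit) exprVn invf_le1 ?exprn_gt0 // exprn_ege1 // ltW. Qed.

Lemma normr_signed_trace c : `|signed_trace eta eta' c| <= 2 * eta ^+ c./2.
Proof.
rewrite /signed_trace normrM normr_sign mul1r (le_trans (ler_normD _ _)) //.
have := normr_conj_pow c./2; rewrite [X in X + _]ger0_norm ?exprn_ge0 ?(ltW eta_gt0) //.
have : 1 <= eta ^+ c./2 by rewrite exprn_ege1 // ltW.
lra.
Qed.

(** All codes but the first have exponents smaller by at least [G], so their traces, together
with [e] and the conjugate of the leading power, are at most [2 * j + 2] times
[eta^(c./2 - G)]. *)
Lemma code_sum_leading (j G : nat) c l e : (size l < j)%N -> gapped G.*2 (c :: l) ->
  `|e| <= 1 ->
  `|code_sum (c :: l) e - (-1) ^+ c * eta ^+ c./2| * eta ^+ G <= (2 * j + 2)%:R * eta ^+ c./2.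
Proof.
move=> lj /= /and3P[gc /allP cl _] e1.
have aG : (G <= c./2)%N by lia.
set y := eta ^+ (c./2 - G).
have yE : eta ^+ c./2 = y * eta ^+ G by rewrite -exprD subnK.
have y1 : 1 <= y by rewrite exprn_ege1 // ltW.
have G0 : 0 < eta ^+ G by rewrite exprn_gt0.
have lb : `|\sum_(c' <- l) signed_trace eta eta' c'| <= j%:R * (2 * y) - 2 * y.
  have -> : j%:R * (2 * y) - 2 * y = (j.-1)%:R * (2 * y).
    by case: j lj => // j _; rewrite mulrS /=; ring.
  apply: (@le_trans _ _ ((size l)%:R * (2 * y))); last first.
    rewrite ler_wpM2r //; first lra.
    by rewrite ler_nat; lia.
  apply: normr_sum_le => c' /cl c'c; apply: le_trans (normr_signed_trace c') _.
  by rewrite ler_wpM2l // /y ler_eXn2l //; lia.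
rewrite {2}yE mulrA ler_wpM2r ?(ltW G0) // /code_sum big_cons /signed_trace.
have -> : forall s : R, (-1) ^+ c * (eta ^+ c./2 + eta' ^+ c./2) + s + e - (-1) ^+ c * eta ^+ c./2
  = (-1) ^+ c * eta' ^+ c./2 + (s + e) by move=> s; ring.
apply: le_trans (ler_normD _ _) _; rewrite normrM normr_sign mul1r.
have := normr_conj_pow c./2.
have := ler_normD (\sum_(c' <- l) signed_trace eta eta' c') e.
rewrite natrD natrM; nra.
Qed.

(** The hypothesis says that [delta = (2 * j + 2) / eta^G] satisfies
[1 + delta < eta * (1 - delta)]; in particular [delta < 1]. *)
Lemma gap_constant_lt (j G : nat) :
  (2 * j + 2)%:R * (eta + 1) < (eta - 1) * eta ^+ G -> (2 * j + 2)%:R < eta ^+ G.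
Proof.
move=> jG; have e1 : 0 < eta - 1 by rewrite subr_gt0.
rewrite -(ltr_pM2l e1); apply: le_lt_trans jG.
by rewrite mulrC ler_wpM2l ?ler0n // lerD2l; lra.
Qed.

(** If [v] is within the relative error [delta] of both leading powers, the exponents agree
because the intervals [(1 - delta, 1 + delta)] scaled by distinct powers of [eta] are
disjoint, and the signs agree because [delta < 1]. *)
Lemma leading_code_unique (j G : nat) c c' (v : R) :
  (2 * j + 2)%:R * (eta + 1) < (eta - 1) * eta ^+ G ->
  `|v - (-1) ^+ c * eta ^+ c./2| * eta ^+ G <= (2 * j + 2)%:R * eta ^+ c./2 ->
  `|v - (-1) ^+ c' * eta ^+ c'./2| * eta ^+ G <= (2 * j + 2)%:R * eta ^+ c'./2 ->
  c = c'.
Proof.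
move=> jG; have G0 : 0 < eta ^+ G by rewrite exprn_gt0.
have J0 : 0 <= (2 * j + 2)%:R :> R by rewrite ler0n.
have gJ := gap_constant_lt jG.
have nlt d d' : `|v - (-1) ^+ d * eta ^+ d./2| * eta ^+ G <= (2 * j + 2)%:R * eta ^+ d./2 ->
    `|v - (-1) ^+ d' * eta ^+ d'./2| * eta ^+ G <= (2 * j + 2)%:R * eta ^+ d'./2 ->
    (d'./2 <= d./2)%N.
  move=> hd hd'; rewrite leqNgt; apply/negP => dd'.
  have e0 : 0 < eta ^+ d./2 by rewrite exprn_gt0.
  have ee : eta * eta ^+ d./2 <= eta ^+ d'./2 by rewrite -exprS ler_eXn2l.
  have h1 : eta ^+ d'./2 <= `|v| + `|v - (-1) ^+ d' * eta ^+ d'./2|.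
    apply: le_trans (ler_normB _ _); rewrite opprB addrC addrNK.
    by rewrite normrM normr_sign mul1r ger0_norm // exprn_ge0 // ltW.
  have h2 : `|v| <= eta ^+ d./2 + `|v - (-1) ^+ d * eta ^+ d./2|.
    rewrite -[X in `|X| <= _](addrNK ((-1) ^+ d * eta ^+ d./2)) addrC (le_trans (ler_normD _ _)) //.
    by rewrite normrM normr_sign mul1r ger0_norm // exprn_ge0 // ltW.
  move: (`|v|) (`|v - (-1) ^+ d * _|) (`|v - (-1) ^+ d' * _|) hd hd' h1 h2 => V D D' hd hd' h1 h2.
  move: (eta ^+ d./2) (eta ^+ d'./2) (eta ^+ G) gJ G0 e0 ee jG hd hd' h1 h2 => x y g.
  move: ((2 * j + 2)%:R : R) J0 => J J0 gJ g0 x0 ee jG hd hd' h1 h2.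
  have : y * g <= (x + D + D') * g by rewrite ler_pM2r //; lra.
  have : y * (g - J) <= x * (g + J) by nra.
  have : eta * x * (g - J) <= y * (g - J) by rewrite ler_pM2r //; lra.
  have : x * (J * (eta + 1)) < x * ((eta - 1) * g) by rewrite ltr_pM2l.
  nra.
move=> hc hc'; have aa : c./2 = c'./2 by apply/eqP; rewrite eqn_leq !nlt.
have [oo|oo] := eqVneq (odd c) (odd c').
  by rewrite -(odd_double_half c) -(odd_double_half c') aa oo.
exfalso; move: hc hc'; rewrite -(signr_odd R c) -(signr_odd R c') -aa.
have e0 : 0 < eta ^+ c./2 by rewrite exprn_gt0.
have -> : (-1) ^+ odd c' = - (-1) ^+ odd c :> R.
  by case: (odd c) (odd c') oo => [] [] //= _; rewrite !(expr0, expr1) ?opprK.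
rewrite mulNr opprK => hc hc'.
have : 2 * eta ^+ c./2 * eta ^+ G <= 2 * (2 * j + 2)%:R * eta ^+ c./2.
  apply: le_trans (_ : _ <= `|v - (-1) ^+ odd c * eta ^+ c./2| * eta ^+ G
    + `|v + (-1) ^+ odd c * eta ^+ c./2| * eta ^+ G) _; last by lra.
  rewrite -mulrDl ler_pM2r //; apply: le_trans (ler_normB _ _).
  rewrite opprD addrA [v - _ - v]addrC addrA addNr add0r -opprD normrN -mulr2n.
  by rewrite normrMn normrM normr_sign mul1r ger0_norm ?(ltW e0) // mulr_natl.
nra.
Qed.

(** The leading codes agree by [leading_code_unique]; subtract their traces and repeat. *)
Lemma code_sum_inj (j G : nat) l l' e e' :
  (2 * j + 2)%:R * (eta + 1) < (eta - 1) * eta ^+ G ->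
  (size l <= j)%N -> size l = size l' -> gapped G.*2 l -> gapped G.*2 l' ->
  `|e| <= 1 -> `|e'| <= 1 -> code_sum l e = code_sum l' e' -> l = l' /\ e = e'.
Proof.
move=> jG; elim: l l' => [|c l IH] [|c' l'] //.
  by move=> _ _ _ _ _ _; rewrite /code_sum !big_nil !add0r.
move=> lj [ll'] gl gl' e1 e1' vv.
have cc : c = c'.
  apply: (leading_code_unique jG (v := code_sum (c :: l) e)); first exact: code_sum_leading.
  by rewrite vv; apply: code_sum_leading => //; rewrite -ll'.
move: gl gl' vv; rewrite -cc /= => /and3P[_ _ gl] /and3P[_ _ gl'].
rewrite /code_sum !big_cons -!addrA => /addrI vv.
by have [-> ->] := IH l' (ltnW lj) ll' gl gl' e1 e1' vv.
Qed.

Definition lower_values (k G N : nat) : seq R :=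
  [seq code_sum l e | l <- gapped_codes G.*2 N k./2, e <- endings 1 k].

Lemma size_lower_values k G N :
  size (lower_values k G N) = ((if odd k then 3 else 1) * 'C(N, k./2))%N.
Proof. by rewrite size_allpairs size_gapped_codes mulnC /endings; case: odd. Qed.

Lemma uniq_lower_values k G N :
  (2 * k./2 + 2)%:R * (eta + 1) < (eta - 1) * eta ^+ G ->
  uniq (lower_values k G N).
Proof.
move=> jG; apply: allpairs_uniq; first exact: uniq_gapped_codes.
  rewrite /endings; case: odd => //=; rewrite !inE ![0 == _]eq_sym oppr_eq0 oner_eq0 /=.
  by rewrite andbT; apply/eqP; lra.
move=> [l e] [l' e'] /allpairsP[[m f] [/= ml fe [-> ->]]].
move=> /allpairsP[[m' f'] [/= ml' fe' [-> ->]]] /= vv.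
have [s1 g1 _] := mem_gapped_codes ml; have [s2 g2 _] := mem_gapped_codes ml'.
have m1 : (size m <= k./2)%N by rewrite s1.
have m12 : size m = size m' by rewrite s1 s2.
by have [-> ->] := code_sum_inj jG m1 m12 g1 g2 (normr_ending fe) (normr_ending fe') vv.
Qed.

(** The choice of [N] keeps every exponent at most [K - G], and a sum is at most twice its
leading power. *)
Lemma lower_values_le k G K (X : R) v :
  (2 * k./2 + 2)%:R * (eta + 1) < (eta - 1) * eta ^+ G -> eta ^+ K <= X ->
  v \in lower_values k G (K - G * (k./2).+1).*2 -> `|v| <= X.
Proof.
move=> jG KX /allpairsP[[l e] [/= ll /normr_ending e1 ->]].
have K1 : 1 <= eta ^+ K by rewrite exprn_ege1 // ltW.
have [ls lg lN] := mem_gapped_codes ll.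
case: l ll ls lg lN => [|c l] ll ls lg lN.
  by rewrite /code_sum big_nil add0r; lra.
have lj : (size l < k./2)%N by rewrite -ls.
have aK : (c./2 + G <= K)%N.
  have KG : (G * (k./2).+1 < K)%N.
    rewrite ltnNge; apply: contraTN ll => KG.
    have -> : (K - G * (k./2).+1)%N = 0%N by apply/eqP; rewrite subn_eq0.
    by rewrite -ls.
  move: lN => /= /andP[+ _]; move: KG; rewrite -!muln2 mulnS mulnAC -divn2.
  by move: (c) (G * k./2)%N; clear; lia.
have lead := code_sum_leading lj lg e1.
apply: le_trans KX; apply: (@le_trans _ _ (eta ^+ (c./2 + G))); last by rewrite ler_eXn2l.
have G0 : 0 < eta ^+ G by rewrite exprn_gt0.
have e0 : 0 < eta ^+ c./2 by rewrite exprn_gt0.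
have h : `|code_sum (c :: l) e| <= eta ^+ c./2 + `|code_sum (c :: l) e - (-1) ^+ c * eta ^+ c./2|.
  rewrite -[X in `|X| <= _](addrNK ((-1) ^+ c * eta ^+ c./2)) addrC (le_trans (ler_normD _ _)) //.
  by rewrite normrM normr_sign mul1r ger0_norm // exprn_ge0 // ltW.
rewrite exprD; apply: le_trans h _.
have J2 : 2 <= (2 * k./2 + 2)%:R :> R by rewrite ler_nat leq_addl.
have gJ := gap_constant_lt jG.
move: lead; move: (`|code_sum (c :: l) e - (-1) ^+ c * eta ^+ c./2|) => D lead.
move: (eta ^+ c./2) (eta ^+ G) ((2 * k./2 + 2)%:R : R) lead G0 e0 gJ J2 {jG} => x g J lead g0 x0 gJ J2.
have D1 : D <= x by rewrite -(ler_pM2r g0); nra.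
nra.
Qed.

End Lower.

(** * Counting *)

Lemma unit_sums_word (R : realType) (d k : nat) (eta : R) (n : int) :
  is_fundamental_unit d eta -> unit_sums R d k n ->
  exists2 w, (size w <= k)%N & word_value eta w = n%:~R.
Proof.
move=> [_ _ gen] [r [rk [u [uu ->]]]].
have /choice [x xE] : forall i, exists x : letter, u i = letter_value eta x.
  move=> i; have [m [->|->]] := gen _ (uu i).
    by exists (false, m); rewrite /letter_value expr0 mul1r.
  by exists (true, m); rewrite /letter_value expr1 mulN1r.
exists (map x (enum 'I_r)); first by rewrite size_map size_enum_ord.
by rewrite /word_value big_map big_enum; apply: eq_bigr => i _.
Qed.

Lemma unit_sums_seq (R : realType) (d k : nat) (s : seq R) (n : int) :
  (forall x, x \in s -> unit_group d x) -> (size s <= k)%N ->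
  n%:~R = \sum_(x <- s) x -> unit_sums R d k n.
Proof.
move=> su sk nE; exists (size s); split=> //; exists (fun i => s`_i); split.
  by move=> i; apply: su; exact: mem_nth.
by rewrite nE (big_nth 0) big_mkord.
Qed.

Section Counting.
Variables (R : realType) (d : nat) (eta eta' : R).
Hypothesis eta_fund : is_fundamental_unit d eta.
Hypothesis eta_unit : quadratic_unit eta eta'.

Let eta_gt1 : 1 < eta := qu_gt1 eta_unit.
Let eta_gt0 : 0 < eta := lt_trans ltr01 eta_gt1.

Lemma conj_eta_unit_group : unit_group d eta'.
Proof.
have [ue _ _] := eta_fund; have [s sE] := qu_norm eta_unit.
have -> : eta' = (-1) ^+ s * eta^-1.
  by rewrite -sE mulrC mulrA mulVf ?mul1r // lt0r_neq0.
case: s {sE}; rewrite ?expr1 ?expr0 ?mulN1r ?mul1r; first apply: unit_groupN.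
  exact: unit_groupV.
exact: unit_groupV.
Qed.

Lemma unit_group_signX (c a : nat) (u : R) : unit_group d u ->
  unit_group d ((-1) ^+ c * u ^+ a).
Proof.
move=> uu; have ua := unit_groupXz a uu.
rewrite -signr_odd; case: odd; rewrite ?expr1 ?expr0 ?mulN1r ?mul1r //.
exact: unit_groupN.
Qed.

(** Each trace is a sum of two units and, if [k] is odd, one unit is left for the ending. *)
Lemma code_sum_unit_sum k l e : size l = k./2 -> e \in endings 1 k ->
  exists2 n : int, n%:~R = code_sum eta eta' l e & unit_sums R d k n.
Proof.
move=> lk ek.
have [n nE] : exists n : int, \sum_(c <- l) signed_trace eta eta' c = n%:~R.
  elim: l {lk} => [|c l [n nE]]; first by exists 0; rewrite big_nil.
  have [m mE] := conj_pair_trace eta_unit (conj_pair_letter_value eta_unit (odd c, (c./2)%:Z)).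
  exists (m + n); rewrite big_cons nE intrD -mE /letter_value /signed_trace /=.
  by rewrite signr_odd -mulrDr.
have [s [su sl sE]] : exists s : seq R, [/\ forall x, x \in s -> unit_group d x,
    size s = (size l).*2 & \sum_(x <- s) x = \sum_(c <- l) signed_trace eta eta' c].
  elim: l {lk n nE} => [|c l [s [su sl sE]]]; first by exists [::]; rewrite !big_nil.
  exists [:: (-1) ^+ c * eta ^+ c./2, (-1) ^+ c * eta' ^+ c./2 & s]; split.
  - move=> x; rewrite !inE => /or3P[/eqP ->|/eqP ->|/su //]; apply: unit_group_signX.
      by have [] := eta_fund.
    exact: conj_eta_unit_group.
  - by rewrite /= sl doubleS.
  - by rewrite !big_cons sE /signed_trace mulrDr addrA.
have [s' [m [su' sl' sE' mE]]] : exists (s' : seq R) (m : int),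
    [/\ forall x, x \in s' -> unit_group d x, (size s' <= odd k)%N,
      \sum_(x <- s') x = e & m%:~R = e].
  move: ek; rewrite /endings; case: odd; rewrite !inE; last first.
    by move/eqP ->; exists [::], 0; rewrite big_nil.
  case/or3P => /eqP ->.
  - by exists [::], 0; rewrite big_nil.
  - exists [:: 1], 1; split=> //; last by rewrite big_seq1.
    by move=> x; rewrite inE => /eqP ->; exact: unit_group1.
  - exists [:: -1], (-1); split=> //; last by rewrite big_seq1.
    by move=> x; rewrite inE => /eqP ->; apply: unit_groupN; exact: unit_group1.
exists (n + m); first by rewrite intrD -nE mE.
apply: (@unit_sums_seq _ _ _ (s ++ s')).
- by move=> x; rewrite mem_cat => /orP[/su|/su'].
- rewrite size_cat sl lk -[leqRHS](odd_double_half k) addnC.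
  by rewrite leq_add2r.
- by rewrite intrD -nE mE big_cat /= sE sE'.
Qed.

Lemma count_upper (k G K H : nat) (X : R) :
  (0 < k)%N -> 4 * k%:R ^+ 2 < eta ^+ G -> X < eta ^+ K.+1 ->
  k%:R * eta ^+ (k.+1 * G) <= H%:R ->
  (unit_sums_count d k X <=
    (if odd k then 3 else 1) * 'C((K.+1 + k * G).+1.*2 + k./2, k./2) +
    (0 < k./2) * (((K.+1 + k * G).+1 * (4 * (k * G).+1).+1 ^ k) ^ (k./2).-1 * H.*2.+1))%N.
Proof.
move=> k0 Gk XK kH; set E := (K.+1 + k * G)%N.
have mE := size_main_values eta eta' k E.
apply: leq_trans (leq_add mE (size_exceptional_values eta k G E H)).
rewrite -size_cat /unit_sums_count -(size_map (fun n : int => n%:~R : R)).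
apply: uniq_leq_size; first by rewrite (map_inj_uniq (@intr_inj R)) fset_uniq.
move=> _ /mapP[n + ->]; rewrite in_fset_set; last exact: finite_unit_sums_upto.
rewrite inE => -[/(unit_sums_word eta_fund) [w wk wE] nX].
rewrite -wE; apply: (word_value_covered eta_unit k0 Gk XK kH wk); last by rewrite wE.
by apply/(integral_wordP eta_unit); exists n.
Qed.

Lemma count_lower (k G K : nat) (X : R) :
  (2 * k./2 + 2)%:R * (eta + 1) < (eta - 1) * eta ^+ G -> eta ^+ K <= X ->
  ((if odd k then 3 else 1) * 'C((K - G * (k./2).+1).*2, k./2) <= unit_sums_count d k X)%N.
Proof.
move=> jG KX; rewrite -(size_lower_values eta eta' k G) /unit_sums_count.
rewrite -(size_map (fun n : int => n%:~R : R)).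
apply: uniq_leq_size; first exact: uniq_lower_values.
move=> v vl; have vX := lower_values_le eta_unit jG KX vl.
move/allpairsP: vl vX => [[l e] [/= /mem_gapped_codes [lk _ _] ek ->]] vX.
have [n nE nk] := code_sum_unit_sum lk ek.
rewrite -nE; apply: map_f; rewrite in_fset_set; last exact: finite_unit_sums_upto.
by rewrite inE; split; rewrite // nE.
Qed.

End Counting.

Lemma ffact_le_exp n m : (n ^_ m <= n ^ m)%N.
Proof.
elim: m => [|m IH]; first by rewrite ffactn0 expn0.
by rewrite ffactnSr expnSr leq_mul // leq_subr.
Qed.

Lemma exp_le_ffact n m : ((n - m) ^ m <= n ^_ m)%N.
Proof.
suff h j : (j <= m)%N -> ((n - m) ^ j <= n ^_ j)%N by exact: h.
elim: j => [|j IH] jm; first by rewrite ffactn0 expn0.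
by rewrite ffactnSr expnSr leq_mul ?IH ?leq_sub2l // ltnW.
Qed.

Lemma exprn_lipschitz (R : realDomainType) (x y B : R) (m : nat) :
  0 <= x <= B -> 0 <= y <= B -> `|x ^+ m.+1 - y ^+ m.+1| <= `|x - y| * (m.+1%:R * B ^+ m).
Proof.
move=> /andP[x0 xB] /andP[y0 yB]; rewrite subrXX normrM ler_wpM2l //.
have -> : m.+1%:R * B ^+ m = \sum_(i < m.+1) B ^+ m.
  by rewrite sumr_const card_ord mulr_natl.
apply: le_trans (ler_norm_sum _ _ _) _; apply: ler_sum => i _.
have im : (i <= m)%N by rewrite -ltnS.
rewrite normrM !normrX !ger0_norm //=.
rewrite -[X in B ^+ X](subnK im) exprD.
by rewrite ler_pM ?exprn_ge0 // lerXn2r // nnegrE; exact: le_trans xB.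
Qed.

(** The falling factorial lies between [(N - m.+1)^m.+1] and [N^m.+1], and both are powers of
numbers at bounded distance from [y]. *)
Lemma binomial_approx (R : realType) (m : nat) (a : R) : 0 <= a ->
  exists2 C : R, 0 <= C & forall (Y y : R) (N : nat), 1 <= Y -> 0 <= y <= 2 * Y ->
    `|N%:R - y| <= a ->
    `|('C(N, m.+1) * m.+1`!)%:R - y ^+ m.+1| <= C * Y ^+ m.
Proof.
move=> a0; pose b := a + m.+1%:R; pose B := 2 + b.
have b0 : 0 <= b by rewrite addr_ge0.
exists (b * (m.+1%:R * B ^+ m)); first by rewrite !mulr_ge0 ?exprn_ge0 // addr_ge0.
move=> Y y N Y1 /andP[y0 yY] Ny.
have m0 : 0 <= m.+1%:R :> R by rewrite ler0n.
have near (n : nat) : `|n%:R - y| <= b ->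
    `|(n ^ m.+1)%:R - y ^+ m.+1| <= b * (m.+1%:R * B ^+ m) * Y ^+ m.
  move=> ny; rewrite natrX; apply: le_trans (@exprn_lipschitz _ _ _ (B * Y) m _ _) _.
  - rewrite ler0n /=; move: ny; rewrite ler_norml => /andP[_]; rewrite /B; nra.
  - rewrite y0 /B; nra.
  by rewrite exprMn -!mulrA ler_wpM2r // !mulr_ge0 // exprn_ge0 // /B; lra.
have n1 : `|N%:R - y| <= b by rewrite /b; lra.
have n2 : `|(N - m.+1)%:R - y| <= b.
  have [mN|mN] := leqP m.+1 N.
    rewrite natrB // addrAC (le_trans (ler_normB _ _)) // normr_nat /b; lra.
  have : N%:R <= m.+1%:R :> R by rewrite ler_nat ltnW.
  have : 0 <= N%:R :> R by rewrite ler0n.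
  move: Ny; rewrite (eqP (ltnW mN : (N - m.+1 == 0)%N)) !ler_norml /b => /andP[h1 h2] h3 h4.
  apply/andP; split; lra.
have := near _ n1; have := near _ n2; rewrite bin_ffact.
have : (N ^_ m.+1)%:R <= (N ^ m.+1)%:R :> R by rewrite ler_nat ffact_le_exp.
have : ((N - m.+1) ^ m.+1)%:R <= (N ^_ m.+1)%:R :> R by rewrite ler_nat exp_le_ffact.
rewrite !ler_norml => h1 h2 /andP[h3 h4] /andP[h5 h6]; apply/andP; split; lra.
Qed.

Lemma exists_power (R : realType) (eta X : R) : 1 < eta -> 1 <= X ->
  exists K : nat, [/\ eta ^+ K <= X, X < eta ^+ K.+1,
    K%:R <= ln X / ln eta & ln X / ln eta < K.+1%:R].
Proof.
move=> e1 X1; have e0 : 0 < eta by lra.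
have X0 : 0 < X by lra.
have le0 : 0 < ln eta by rewrite ln_gt0.
have q0 : 0 <= ln X / ln eta by rewrite divr_ge0 ?ln_ge0 // ltW.
have /andP[h1 h2] := archimedean.Num.Theory.truncn_itv q0.
exists (Num.truncn (ln X / ln eta)); split=> //.
  rewrite -ler_ln ?posrE ?exprn_gt0 // lnXn // -mulr_natl.
  by rewrite -ler_pdivlMr.
rewrite -ltr_ln ?posrE ?exprn_gt0 // lnXn // -mulr_natl.
by rewrite -ltr_pdivrMr.
Qed.

(** * The asymptotic formula *)

Lemma exists_power_gt (R : realType) (eta B : R) : 1 < eta ->
  exists G : nat, B < eta ^+ G.
Proof.
move=> e1; have B1 : 1 <= 1 + `|B| by rewrite lerDl.
have [K [_ h _ _]] := exists_power e1 B1.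
by exists K.+1; apply: le_lt_trans h; have := ler_norm B; lra.
Qed.

(** Transfers the two binomial estimates [L] and [U], each [F]-fold close to [y], to any [n]
between them, with room [A * Y] for the exceptional values. *)
Lemma main_term_error (R : realType) (c y F Y L U A e0 e1 : R) :
  0 <= c <= 3 -> 1 <= F ->
  `|L * F - y| <= e0 * Y -> `|U * F - y| <= e1 * Y -> 0 <= e0 -> 0 <= e1 -> 0 <= Y -> 0 <= A ->
  forall n : R, c * L <= n -> n <= c * U + A * Y ->
  `|n - c / F * y| <= (3 * e0 + 3 * e1 + A) * Y.
Proof.
move=> /andP[c0 c3] F1 hL hU e00 e10 Y0 A0 n nL nU.
have F0 : 0 < F by lra.
have cF0 : 0 <= c / F by rewrite divr_ge0 // ltW.
have cF3 : c / F <= 3 by rewrite ler_pdivrMr //; nra.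
have cE z : c * z = c / F * (z * F) by rewrite mulrA [c / F * z]mulrAC divfK ?lt0r_neq0.
rewrite !(cE L) in nL; rewrite (cE U) in nU.
move: hL hU; rewrite !ler_norml => /andP[l1 l2] /andP[u1 u2].
have : c / F * (e0 * Y) <= 3 * (e0 * Y) by rewrite ler_wpM2r // mulr_ge0.
have : c / F * (e1 * Y) <= 3 * (e1 * Y) by rewrite ler_wpM2r // mulr_ge0.
have : c / F * (y - e0 * Y) <= c / F * (L * F) by rewrite ler_wpM2l //; lra.
have : c / F * (U * F) <= c / F * (y + e1 * Y) by rewrite ler_wpM2l //; lra.
rewrite mulrBr mulrDr => h1 h2 h3 h4.
have : 0 <= e0 * Y by rewrite mulr_ge0.
have : 0 <= e1 * Y by rewrite mulr_ge0.
have : 0 <= A * Y by rewrite mulr_ge0.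
by move=> *; apply/andP; split; lra.
Qed.

(** The bounds [count_lower] and [count_upper] are applied with [eta^K <= X < eta^K.+1], and
[K + 1] is [O(ln X)] because [X >= 2].  For [k./2 = 0] the two bounds coincide and
the count is exact. *)
Lemma unit_sums_asymptotic (R : realType) (d k : nat) (eta eta' : R) :
  (0 < k)%N -> is_fundamental_unit d eta -> quadratic_unit eta eta' ->
  exists C : R, forall X : R, 2 <= X ->
    `| (unit_sums_count d k X)%:R - main_coef R k * (2 * ln X / ln eta) ^+ k./2 |
      <= C * (ln X) ^ ((k./2)%:Z - 1).
Proof.
move=> k0 fund unit; have e1 := qu_gt1 unit; have e0 : 0 < eta by lra.
have le0 : 0 < ln eta by rewrite ln_gt0.
(* The second term is the gap that separates the leading powers in the lower bound. *)
have [G] := exists_power_gt (4 * k%:R ^+ 2 + (2 * k./2 + 2)%:R * (eta + 1) / (eta - 1)) e1.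
have t1 : 0 <= (2 * k./2 + 2)%:R * (eta + 1) / (eta - 1).
  by rewrite divr_ge0 ?mulr_ge0 ?ler0n //; lra.
have t2 : 0 <= 4 * k%:R ^+ 2 :> R by rewrite mulr_ge0 ?sqr_ge0.
move=> hG; have Gk : 4 * k%:R ^+ 2 < eta ^+ G by lra.
have jG : (2 * k./2 + 2)%:R * (eta + 1) < (eta - 1) * eta ^+ G.
  by rewrite mulrC [ltRHS]mulrC -ltr_pdivrMr ?subr_gt0 // mulrC; lra.
(* [H] bounds the integer carried by the letters near the exponent 0. *)
pose H := (Num.truncn (k%:R * eta ^+ (k.+1 * G))).+1.
have kH : k%:R * eta ^+ (k.+1 * G) <= H%:R.
  by rewrite ltW // archimedean.Num.Theory.truncnS_gt.
have up X K XK := count_upper fund unit (k := k) (G := G) (K := K) (H := H) (X := X) k0 Gk XK kH.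
have lo X K KX := count_lower fund unit (k := k) (G := G) (K := K) (X := X) jG KX.
rewrite /main_coef; case kr: k./2 up lo => [|m] up lo.
  exists 0 => X X2; have X1 : 1 <= X by lra.
  have [K [KX XK _ _]] := exists_power e1 X1.
  have := up X K XK; have := lo X K KX; rewrite !bin0 muln1 mul0n addn0 => h1 h2.
  have -> : unit_sums_count d k X = (if odd k then 3 else 1)%N.
    by apply/eqP; rewrite eqn_leq h1 h2.
  rewrite expr0 mulr1 fact0 divr1 mul0r.
  by case: odd; rewrite subrr normr0.
(* [a] bounds the distance from [2 * ln X / ln eta] to the upper indices of both binomial
   coefficients. *)
pose a := (2 * (2 + k * G) + m.+1 + 2 * G * m.+2 + 2)%:R : R.
have [C0 C00 hC] := @binomial_approx R m a (ler0n _ _).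
set P := ((4 * (k * G).+1).+1 ^ k)%N in up.
pose A := (((2 + k * G) * P) ^ m * H.*2.+1)%:R : R.
have A0 : 0 <= A by exact: ler0n.
pose b := (ln eta)^-1 + (ln 2)^-1.
have l20 : 0 < ln (2 : R) by rewrite ln_gt0 //; lra.
have b0 : 0 <= b by rewrite addr_ge0 ?invr_ge0 ?ltW.
exists ((3 * C0 + 3 * C0 + A) * b ^+ m) => X X2; have X1 : 1 <= X by lra.
have [K [KX XK KM MK]] := exists_power e1 X1.
have -> : (m.+1%:Z - 1) = m%:Z by rewrite intS addrC addKr.
rewrite -exprnP -[leRHS]mulrA -exprMn.
have lX2 : ln 2 <= ln X by rewrite ler_ln ?posrE //; lra.
set M := ln X / ln eta in KM MK *.
have K0 : 0 <= K%:R :> R by rewrite ler0n.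
pose Y : R := K.+1%:R.
have YE : Y = K%:R + 1 by rewrite /Y -natr1.
have Y1 : 1 <= Y by rewrite YE; lra.
have Y0 : 0 <= Y by lra.
have YX : Y <= b * ln X.
  rewrite /b mulrDl [_^-1 * _]mulrC -/M YE lerD //.
  by rewrite mulrC ler_pdivlMr ?mul1r.
have bX0 := le_trans Y0 YX.
apply: le_trans (_ : _ <= (3 * C0 + 3 * C0 + A) * Y ^+ m) _; last first.
  by rewrite ler_wpM2l ?lerXn2r ?nnegrE // !addr_ge0 ?mulr_ge0.
rewrite -(mulrA 2) -/M.
have y2 : 0 <= 2 * M <= 2 * Y by rewrite YE; apply/andP; split; move: MK; rewrite -natr1; lra.
have cE : (if odd k then 3 else 1 : R) = (if odd k then 3 else 1)%N%:R by case: odd.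
have N0 : `|(K - G * m.+2).*2%:R - 2 * M| <= a.
  have : ((K - G * m.+2).*2)%:R <= (2 * K)%:R :> R.
    by rewrite ler_nat -mul2n leq_mul2l leq_subr.
  have : (2 * K)%:R <= ((K - G * m.+2).*2 + 2 * G * m.+2)%:R :> R.
    by rewrite ler_nat -mul2n -mulnA; move: (G * m.+2)%N; clear; lia.
  have : (2 * G * m.+2 + 2)%:R <= a by rewrite ler_nat -addnA leq_addl.
  rewrite ler_norml !natrD natrM; move: MK; rewrite -natr1.
  have : 0 <= (2 * G * m.+2)%:R :> R by rewrite ler0n.
  by move=> *; apply/andP; split; lra.
have N1 : `|((K.+1 + k * G).+1.*2 + m.+1)%:R - 2 * M| <= a.
  have -> : ((K.+1 + k * G).+1.*2 + m.+1 = 2 * K + (2 * (2 + k * G) + m.+1))%N.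
    by rewrite -mul2n; ring.
  have : (2 * (2 + k * G) + m.+1)%:R + 2 <= a.
    by rewrite -(natrD _ _ 2) ler_nat leq_add2r leq_addr.
  have : 0 <= (2 * (2 + k * G) + m.+1)%:R :> R by rewrite ler0n.
  rewrite ler_norml natrD natrM; move: MK; rewrite -natr1.
  by move=> *; apply/andP; split; lra.
have h0 := hC _ _ _ Y1 y2 N0; have h1 := hC _ _ _ Y1 y2 N1.
rewrite natrM in h0; rewrite natrM in h1.
apply: (main_term_error _ _ h0 h1) => //.
- by case: odd; lra.
- by rewrite ler1n fact_gt0.
- by rewrite exprn_ge0 //; lra.
- by rewrite cE -natrM ler_nat; exact: lo.
apply: (@le_trans _ _ _ _ _ (_ : _ <= _%:R)); first by rewrite ler_nat; exact: (up X K XK).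
rewrite natrD natrM cE lerD2l mul1n /= /A /Y -natrX -natrM ler_nat.
have leq_exp u v : (u <= v -> u ^ m <= v ^ m)%N.
  by case: (m) => [|m'] uv; rewrite ?expn0 // leq_exp2r.
rewrite mulnAC -expnMn leq_mul2r; apply/orP; right; apply: leq_exp.
rewrite mulnAC leq_mul2r; apply/orP; right.
have : (K <= (2 + k * G) * K)%N by rewrite leq_pmull.
by rewrite mulnS; move: ((2 + k * G) * K)%N (k * G)%N; clear; lia.
Qed.

Theorem theorem1 (R : realType) (d : nat) (d_ge2 : (2 <= d)%N)
    (d_sqfree : squarefree d) (k : nat) (k_gt0 : (0 < k)%N) :
  exists C : R, forall eta : R, is_fundamental_unit d eta ->
    forall X : R, 2 <= X ->
      `| (unit_sums_count d k X)%:R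
         - main_coef R k * (2 * ln X / ln eta) ^+ k./2 |
      <= C * (ln X) ^ ((k./2)%:Z - 1).
Proof.
(* The constant may depend on [eta], which the field determines. *)
have [[eta0 fund0]|none] := pselect (exists eta : R, is_fundamental_unit d eta); last first.
  by exists 0 => eta fund; case: none; exists eta.
have [eta' unit0] := fundamental_quadratic_unit d_ge2 d_sqfree fund0.
have [C hC] := unit_sums_asymptotic k_gt0 fund0 unit0.
by exists C => eta fund; rewrite (fundamental_unit_unique fund fund0).
Qed.
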